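(* Let $q$ be a prime power and $M\geq 2$ an integer with $(M,q)=1$. For $m\geq1$ let $s^M_{\mathrm{Sp}}(m,q)$ be the proportion of elements of $\mathrm{Sp}(2m,q)$ that are separable and are $M$-th powers in $\mathrm{Sp}(2m,q)$, and let $S^M_{\mathrm{Sp}}(q,u)=1+\sum_{m\geq1}s^M_{\mathrm{Sp}}(m,q)u^m$. Then, as formal power series in $u$, $$S^M_{\mathrm{Sp}}(q,u)=\prod_{d=1}^{\infty}\left(1+\frac{u^d}{q^d+1}\right)^{N^*_M(q,2d)}\prod_{d=1}^{\infty}\left(1+\frac{u^d}{q^d-1}\right)^{R^*_M(q,2d)}.$$
   Context: $\mathrm{Sp}(2m,q)$ is the symplectic group of a non-degenerate alternating form on $\mathbb{F}_q^{2m}$. An element $X$ of a group $G$ is an $M$-th power in $G$ if $Y^M=X$ for some $Y\in G$. A matrix is separable if its characteristic polynomial has no repeated roots. For monic $f$ of degree $r$ with $f(0)\ne0$, $f^*(x)=f(0)^{-1}x^rf(x^{-1})$; SRIM means irreducible monic with $f=f^*$. A monic irreducible $g\neq x$ of degree $k$ is an $M$-power polynomial if $g(x^M)$ has a monic irreducible factor of degree $k$. A SRIM $f$ of degree $2k$ is an $M^*$-power SRIM polynomial if $f(x^M)$ has a SRIM factor of degree $2k$. $N^*_M(q,2d)$ is the number of $M^*$-power SRIM polynomials of degree $2d$ over $\mathbb{F}_q$. $R^*_M(q,2d)$ is the number of unordered pairs $\{\varphi,\varphi^*\}$ where $\varphi\in\mathbb{F}_q[x]$ is a monic irreducible $M$-power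 polynomial of degree $d$ with $\varphi\neq\varphi^*$. *)

(* Defs.v *)
From HB Require Import structures.
From mathcomp Require Import all_boot all_order all_algebra all_fingroup all_field.
From mathcomp Require Import boolp.
Set Implicit Arguments. Unset Strict Implicit. Unset Printing Implicit Defensive.
Import Order.TTheory GRing.Theory Num.Theory.
Local Open Scope ring_scope.

Section Defs.
Variable F : finFieldType.

Definition sympJ (m : nat) : 'M[F]_(m + m) :=
  block_mx 0 1%:M (- 1%:M) 0.

Definition Sp (m : nat) : {set 'M[F]_(m + m)} :=
  [set A : 'M[F]_(m + m) | A^T *m sympJ m *m A == sympJ m].

Definition separable_mx (n : nat) (X : 'M[F]_n) : bool :=
  separable_poly (char_poly X).

Definition is_Mth_power_Sp (M m : nat) (X : 'M[F]_(m + m)) : bool :=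
  [exists Y in Sp m, Y ^+ M == X].

Definition sSp (M m : nat) : rat :=
  (#|[set X in Sp m | separable_mx X && is_Mth_power_Sp M X]|%:R)
  / (#|Sp m|%:R).

Definition SSp_coef (M m : nat) : rat := if m == 0%N then 1 else sSp M m.

(* f^*(x) = f(0)^{-1} x^r f(x^{-1}), r = deg f. *)
Definition recip (f : {poly F}) : {poly F} := (f`_0)^-1 *: Poly (rev f).

Definition SRIM (f : {poly F}) : Prop :=
  [/\ f \is monic, irreducible_poly f & f = recip f].

Definition compXM (M : nat) (g : {poly F}) : {poly F} := comp_poly 'X^M g.

Definition Mpower_poly (M k : nat) (g : {poly F}) : Prop :=
  [/\ g \is monic, irreducible_poly g, g <> 'X, size g = k.+1 &
      exists h : {poly F}, [/\ h \is monic, irreducible_poly h,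
                              size h = k.+1 & h %| compXM M g]].

Definition Mstar_SRIM (M k : nat) (f : {poly F}) : Prop :=
  [/\ SRIM f, size f = (k.*2).+1 &
      exists h : {poly F}, [/\ SRIM h, size h = (k.*2).+1 & h %| compXM M f]].

Definition polyT (n : nat) (t : {ffun 'I_n -> F}) : {poly F} := \poly_(i < n) (if insub i is Some j then t j else 0).

Definition coefT (n : nat) (p : {poly F}) : {ffun 'I_n -> F} := [ffun i : 'I_n => p`_i].

(* N^*_M(q,2d): polynomials of degree 2d, represented faithfully (and
   injectively) by their (2d+1) coefficients. *)
Definition NstarM (M d : nat) : nat :=
  #|[set t : {ffun 'I_((d.*2).+1) -> F} | `[< Mstar_SRIM M d (polyT t) >] ]|.

Definition RstarM (M d : nat) : nat :=
  #|[set [set t; coefT d.+1 (recip (polyT t))] |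
      t in [set t : {ffun 'I_d.+1 -> F} |
              `[< Mpower_poly M d (polyT t) /\ polyT t <> recip (polyT t) >] ] ]|.

End Defs.

(* Main.v *)
Require Import Defs.
From HB Require Import structures.
From mathcomp Require Import all_boot all_order all_algebra all_fingroup all_field.
From mathcomp Require Import boolp zify ring.
Import Order.TTheory GRing.Theory Num.Theory.
Local Open Scope ring_scope.

(* Write ev a p for the value of p at a point a of an algebraic closure of F,
   and let X be symplectic with separable characteristic polynomial f. The
   roots of f are closed under inversion and none is its own inverse, and the
   centralizer of X is F[X] = F[x]/f, on which the adjoint of the symplectic
   form acts by x -> 1/x.

   Counting. Count the invertible P such that P C P^-1 is symplectic, where C
   is any matrix with characteristic polynomial f. Through P C P^-1 there are
   |C_GL(C)| of them per symplectic matrix with characteristic polynomial f;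
   through P^T J P there are |Sp| of them per nondegenerate alternating form
   preserved by C. Such forms are a torsor under the units of F[x]/f fixed by
   x -> 1/x, so the proportion of symplectic matrices with characteristic
   polynomial f is U(f) / V(f), where V counts the units of F[x]/f and U the
   fixed ones. By the Chinese remainder theorem this is multiplicative over
   the "atoms" of f (the self-reciprocal irreducible factors, and the products
   of another irreducible factor with its reciprocal), and an atom of degree 2d
   contributes (q^d - 1) / (q^2d - 1) or (q^d - 1) / (q^d - 1)^2 accordingly.

   Powers. An M-th root of X in Sp lies in F[X], hence is given by a polynomial
   p with ev a p ^ M = a and ev (1/a) p * ev a p = 1 at each root a of f. This
   condition can be tested on each atom, where it says that the atom is built
   from M^*-power or M-power polynomials. Summing the proportions over all sets
   of such atoms expands the product in the statement. *)
Set Implicit Arguments.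
Unset Strict Implicit.
Unset Printing Implicit Defensive.

(** * Values at points of an algebraic closure *)

Section Evaluation.
Variables (F : fieldType) (L : closedFieldType) (iota : {rmorphism F -> L}).
Implicit Types (f g h p q : {poly F}) (a b : L).

Definition ev a : {poly F} -> L := horner_eval a \o map_poly iota.

HB.instance Definition _ a :=
  GRing.RMorphism.copy (ev a) (horner_eval a \o map_poly iota).

Lemma evE a p : ev a p = (map_poly iota p).[a].
Proof. by []. Qed.

Lemma evX a : ev a 'X = a.
Proof. by rewrite evE map_polyX hornerX. Qed.

Lemma evC a c : ev a c%:P = iota c.
Proof. by rewrite evE map_polyC hornerC. Qed.

Lemma evZ a c p : ev a (c *: p) = iota c * ev a p.
Proof. by rewrite -mul_polyC rmorphM /= evC. Qed.

Lemma ev_comp a p q : ev a (p \Po q) = ev (ev a q) p.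
Proof. by rewrite !evE map_comp_poly horner_comp. Qed.

Lemma ev_dvd a p q : p %| q -> ev a p = 0 -> ev a q = 0.
Proof. by move=> /dvdpP[r ->] pa; rewrite rmorphM /= pa mulr0. Qed.

Lemma ev_mod a p f : ev a f = 0 -> ev a (p %% f) = ev a p.
Proof.
by move=> fa; rewrite {2}(divp_eq p f) rmorphD rmorphM /= fa mulr0 add0r.
Qed.

Lemma ev_mul_eq0 a p q : ev a (p * q) = 0 <-> ev a p = 0 \/ ev a q = 0.
Proof.
rewrite rmorphM /=; split=> [/eqP|]; last by case=> ->; rewrite ?mul0r ?mulr0.
by rewrite mulf_eq0 => /orP[] /eqP; [left | right].
Qed.

Lemma self_inverse_rational a : a != 0 -> a = a^-1 -> exists2 c, a = iota c & c * c = 1.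
Proof.
move=> a0 aV; have : a ^+ 2 == 1 by rewrite expr2 {2}aV mulfV.
rewrite sqrf_eq1 => /orP[] /eqP->; [exists 1 | exists (-1)] => //.
- by rewrite rmorph1.
- by rewrite mulr1.
- by rewrite rmorphN1.
- by rewrite mulrNN mulr1.
Qed.

(** The gcd computed over [F] is still the gcd over [L], where it is constant as soon as it has no
    root. *)
Lemma coprimep_evP p q :
  reflect (forall a, ev a q = 0 -> ev a p != 0) (coprimep p q).
Proof.
apply: (iffP idP) => [cpq a qa | pq].
  have := coprimep_root (x := a) (p := map_poly iota q) (q := map_poly iota p).
  by rewrite coprimep_map coprimep_sym => /(_ cpq); apply; apply/rootP.
rewrite -(coprimep_map iota) /coprimep; apply/contraT => /closed_rootP[a].
by rewrite root_gcd => /andP[/rootP pa /rootP /pq]; rewrite evE pa eqxx.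
Qed.

(** An irreducible polynomial is coprime to [p] or divides it, and a common root rules out the
    former. This carries identities from one root of [g] to all its conjugates. *)
Lemma irr_dvd a g p : irreducible_poly g -> ev a g = 0 -> ev a p = 0 -> g %| p.
Proof.
move=> g_irr ga pa; apply/contraT; rewrite -irreducible_poly_coprime //.
by move=> /coprimep_evP /(_ a pa); rewrite ga eqxx.
Qed.

Lemma ev_root_exists g : (1 < size g)%N -> exists a, ev a g = 0.
Proof.
move=> sg; have /closed_rootP[a /rootP ga] : size (map_poly iota g) != 1.
  by rewrite size_map_poly; case: (size g) sg => [|[|]].
by exists a.
Qed.

Lemma irr_monic_eq a g h : irreducible_poly g -> irreducible_poly h ->
  g \is monic -> h \is monic -> ev a g = 0 -> ev a h = 0 -> g = h.
Proof.
move=> gi hi gm hm ga ha; apply/eqP; rewrite -eqp_monic //.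
by rewrite /eqp (irr_dvd gi ga ha) (irr_dvd hi ha ga).
Qed.

(** Over [L], a separable [f] is a constant times a product of distinct linear factors, each
    dividing [p]; divisibility then descends to [F]. *)
Lemma sep_dvd f p : separable_poly f ->
  (forall a, ev a f = 0 -> ev a p = 0) -> f %| p.
Proof.
move=> fsep fp; have f0 : f != 0 by rewrite separable_poly_neq0.
rewrite -(dvdp_map iota).
have [rs Ef] := closed_field_poly_normal (map_poly iota f).
have lf0 : lead_coef (map_poly iota f) != 0 by rewrite lead_coef_eq0 map_poly_eq0.
rewrite Ef dvdpZl //; apply: uniq_roots_dvdp; last first.
  rewrite uniq_rootsE -separable_prod_XsubC.
  by move: fsep; rewrite -(separable_map iota) Ef (eqp_separable (eqp_scale _ lf0)).
apply/allP => x xrs; apply/rootP; apply: fp.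
by rewrite evE Ef hornerZ; apply/eqP; rewrite mulf_eq0 -rootE root_prod_XsubC xrs orbT.
Qed.

Lemma crt g h p q : coprimep g h -> exists r,
  (forall a, ev a g = 0 -> ev a r = ev a p) /\
  (forall a, ev a h = 0 -> ev a r = ev a q).
Proof.
move=> /Bezout_eq1_coprimepP[[u v] /= uv].
exists (p * (v * h) + q * (u * g)); split=> a ga;
  have := congr1 (ev a) uv; rewrite !rmorphD !rmorphM rmorph1 /= ga !mulr0.
  by rewrite add0r addr0 => ->; rewrite mulr1.
by rewrite add0r addr0 => ->; rewrite mulr1.
Qed.

Lemma ev_inv p f : coprimep p f ->
  exists y, forall a, ev a f = 0 -> ev a y = (ev a p)^-1.
Proof.
move=> /Bezout_eq1_coprimepP[[u v] /= uv]; exists u => a fa.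
have := congr1 (ev a) uv; rewrite rmorphD !rmorphM rmorph1 /= fa mulr0 addr0 => upa.
have pa : ev a p != 0 by apply: contra_eq_neq upa => ->; rewrite mulr0 eq_sym oner_eq0.
by apply: (mulIf pa); rewrite upa mulVf.
Qed.

Lemma ev_invX f : (forall a, ev a f = 0 -> a != 0) ->
  exists y, forall a, ev a f = 0 -> ev a y = a^-1.
Proof.
move=> f0; have [|y yP] := @ev_inv 'X f.
  by apply/coprimep_evP => a; rewrite evX; apply: f0.
by exists y => a fa; rewrite yP // evX.
Qed.

Lemma ev_neq0 a g : irreducible_poly g -> ev a g = 0 ->
  g \is monic -> g != 'X -> a != 0.
Proof.
move=> gi ga gm; apply: contraNneq => a0; apply/eqP.
have Xi : irreducible_poly ('X : {poly F}).
  by have := irredp_XsubC (0 : F); rewrite subr0.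
by apply: (irr_monic_eq (a := a) gi Xi gm (monicX _)); rewrite ?evX.
Qed.

Hypothesis algL : integralRange iota.

Lemma minpoly_exists a :
  exists g, [/\ g \is monic, irreducible_poly g & ev a g = 0].
Proof.
have [p pm /rootP pa] := algL a.
have [g]: exists g, [/\ g \is monic, ev a g = 0 &
    forall q, q != 0 -> ev a q = 0 -> (size g <= size q)%N].
  (* Descent on the size: as long as a smaller nonzero annihilator of [a] exists, its normalization
     replaces [p]. *)
  have [k] := ubnP (size p); elim: k => // k IHk in p pm pa *.
  rewrite ltnS => sp.
  have [[q [q0 qa qs]]|nq] := pselect (exists q, [/\ q != 0, ev a q = 0 & (size q < size p)%N]).
    have lq : lead_coef q != 0 by rewrite lead_coef_eq0.
    apply: (IHk ((lead_coef q)^-1 *: q)).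
    - by rewrite monicE lead_coefZ mulVf.
    - by rewrite -evE evZ qa mulr0.
    - by rewrite size_scale ?invr_eq0 //; apply: leq_trans sp.
  exists p; split=> // q q0 qa; rewrite leqNgt; apply/negP => qp.
  by apply: nq; exists q.
case=> gm ga gmin; have g0 := monic_neq0 gm.
exists g; split=> //; split.
  rewrite ltnNge; apply/negP => /size1_polyC Eg.
  move: g0 ga; rewrite Eg evC polyC_eq0 => g0 /eqP.
  by rewrite fmorph_eq0 (negPf g0).
move=> q sq /dvdpP[r Eg]; move: g0 (ga); rewrite Eg => /[dup]; rewrite {1}mulf_eq0.
case/norP=> r0 q0 rq0 /eqP; rewrite rmorphM mulf_eq0 => /orP[] /eqP za.
  have := gmin _ r0 za; rewrite Eg size_mul //.
  move: sq q0 r0; rewrite -!size_poly_gt0.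
  by case: (size q) (size r) => [|[|j]] // [|k] // _ _ _; lia.
have := gmin _ q0 za; rewrite Eg size_mul //.
rewrite eqp_sym -[X in _ %= X]mul1r eqp_mul2r // -size_poly_eq1.
move: q0 r0; rewrite -!size_poly_gt0.
by case: (size q) (size r) => [|j] // [|[|k]] // _ _; lia.
Qed.

End Evaluation.

(** * Matrices with separable characteristic polynomial *)

Lemma horner_mx_intertwine (R : comNzRingType) m n (A : 'M[R]_m.+1)
    (A' : 'M[R]_n.+1) (B : 'M[R]_(m.+1, n.+1)) p :
  A *m B = B *m A' -> horner_mx A p *m B = B *m horner_mx A' p.
Proof.
move=> AB; elim/poly_ind: p => [|p c IHp]; first by rewrite !rmorph0 mul0mx mulmx0.
rewrite !rmorphD !rmorphM /= !horner_mx_X !horner_mx_C mulmxDl mulmxDr.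
by rewrite -!mulmxE -mulmxA AB !mulmxA IHp scalar_mxC.
Qed.

Lemma eigenvector_horner (R : comNzRingType) n (A : 'M[R]_n.+1) (v : 'rV_n.+1) a p :
  v *m A = a *: v -> v *m horner_mx A p = p.[a] *: v.
Proof.
move=> vA; elim/poly_ind: p => [|p c IHp].
  by rewrite rmorph0 mulmx0 horner0 scale0r.
rewrite rmorphD rmorphM /= horner_mx_X horner_mx_C mulmxDr -mulmxE mulmxA IHp.
by rewrite -scalemxAl vA mul_mx_scalar hornerMXaddC scalerDl scalerA.
Qed.

Lemma trmx_horner (R : comNzRingType) n (A : 'M[R]_n.+1) p :
  (horner_mx A p)^T = horner_mx A^T p.
Proof.
elim/poly_ind: p => [|p c IHp]; first by rewrite !rmorph0 trmx0.
rewrite !rmorphD !rmorphM /= !horner_mx_X !horner_mx_C linearD /= tr_scalar_mx.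
rewrite -!mulmxE trmx_mul IHp; congr (_ + _).
by rewrite [LHS](@comm_mx_horner _ _ _ _ p (comm_mx_refl _)).
Qed.

Section Cyclic.
Variables (F : fieldType) (L : closedFieldType) (iota : {rmorphism F -> L}).
Hypothesis algL : integralRange iota.
Local Notation ev := (ev iota).
Variables (n : nat).
Implicit Types (X Z : 'M[F]_n.+1) (f g h p q : {poly F}) (a b : L).

Lemma eigenvector_ev X a : ev a (char_poly X) = 0 ->
  exists2 v : 'rV[L]_n.+1, v != 0 & v *m map_mx iota X = a *: v.
Proof.
move=> /rootP; rewrite map_char_poly -eigenvalue_root_char.
by move=> /eigenvalueP[v vX v0]; exists v.
Qed.

(** A row eigenvector over [L] for a root [a] is scaled by p(a) under p(X), so p(X) = 0 makes [p]
    vanish at every root. Thus the characteristic polynomial is also the minimal one. *)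
Lemma horner_mx_eq0 X p : separable_poly (char_poly X) ->
  horner_mx X p = 0 <-> char_poly X %| p.
Proof.
move=> fsep; split=> [pX|/dvdpP[q ->]]; last first.
  by rewrite rmorphM /= Cayley_Hamilton mulr0.
apply: (sep_dvd (iota := iota) fsep) => a /eigenvector_ev[v v0 vX].
have := eigenvector_horner (map_poly iota p) vX.
rewrite -map_horner_mx pX map_mx0 mulmx0 => /esym/eqP.
by rewrite scaler_eq0 (negPf v0) orbF => /eqP.
Qed.

Lemma horner_mx_eq X p q : separable_poly (char_poly X) ->
  horner_mx X p = horner_mx X q <->
  (forall a, ev a (char_poly X) = 0 -> ev a p = ev a q).
Proof.
move=> fsep; split=> [pq a fa|pq].
  apply/eqP; rewrite -subr_eq0 -rmorphB /=; apply/eqP; apply: ev_dvd fa.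
  by apply/horner_mx_eq0 => //; rewrite rmorphB /= pq subrr.
apply/eqP; rewrite -subr_eq0 -rmorphB /=; apply/eqP; apply/horner_mx_eq0 => //.
by apply: (sep_dvd (iota := iota) fsep) => a fa; rewrite rmorphB /= pq ?subrr.
Qed.

Lemma horner_mx_unit X p :
  horner_mx X p \in unitmx <-> coprimep p (char_poly X).
Proof.
split=> [pX|/Bezout_eq1_coprimepP[[u v] /= uv]]; last first.
  have := congr1 (horner_mx X) uv; rewrite rmorphD !rmorphM /= rmorph1.
  by rewrite Cayley_Hamilton mulr0 addr0 => /mulmx1_unit[].
apply/(coprimep_evP iota) => a /eigenvector_ev[v v0 vX].
have := eigenvector_horner (map_poly iota p) vX.
rewrite -map_horner_mx evE => vpX; apply: contraNneq v0 => pa0.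
have upX : map_mx iota (horner_mx X p) \in unitmx by rewrite map_unitmx.
by rewrite -[v](mulmxK upX) vpX pa0 scale0r mul0mx.
Qed.

(** Induction on the size of [g]. If [g] is irreducible and f = s g, a nonzero row of s(X) works; if
    g = r h with nonconstant factors, coprime by separability, the vectors for [r] and [h] are
    added. For g = f this yields a cyclic vector. *)
Lemma vector_of_annihilator X g : separable_poly (char_poly X) ->
  g %| char_poly X ->
  exists v : 'rV_n.+1, forall p, v *m horner_mx X p = 0 <-> g %| p.
Proof.
set f := char_poly X => fsep.
have f0 : f != 0 := separable_poly_neq0 fsep.
have [k] := ubnP (size g); elim: k g => // k IHk g; rewrite ltnS => sg gf.
have g0 : g != 0 by apply: contraNneq f0 => E; move: gf; rewrite E dvd0p.
have [g1|g1] := eqVneq (size g) 1.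
  exists 0 => p; rewrite mul0mx; split=> // _.
  by apply: (@dvdp_trans _ 1); rewrite ?dvd1p // dvdp1 g1.
have [a ga] : exists a, ev a g = 0.
  by apply: ev_root_exists; move: g0 g1; rewrite -size_poly_gt0; case: size => [|[]].
have [h [hm hi ha]] := minpoly_exists algL a.
have hg : h %| g := irr_dvd hi ha ga.
case/dvdpP: (hg) => r Eg.
have [r1|r1] := eqVneq (size r) 1.
  have Eh : g %= h.
    by rewrite Eg -[X in _ %= X]mul1r eqp_mul2r ?monic_neq0 // -size_poly_eq1 r1.
  case/dvdpP: gf => s Ef.
  have sX : horner_mx X s != 0.
    apply/eqP => /horner_mx_eq0 -/(_ fsep); rewrite -/f Ef -[X in _ %| X]mul1r.
    have s0 : s != 0 by apply: contraNneq f0 => E; rewrite Ef E mul0r.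
    rewrite [s * g]mulrC dvdp_mul2r // dvdp1 => /eqP; exact/eqP.
  have [i wX] : exists i, row i (horner_mx X s) != 0.
    apply/existsP; apply: contraNT sX; rewrite negb_exists => /forallP s0.
    by apply/eqP/row_matrixP => i; rewrite row0; apply/eqP; have := s0 i; rewrite negbK.
  pose v := row i (horner_mx X s).
  have vE q : v *m horner_mx X q = row i (horner_mx X (s * q)).
    by rewrite -row_mul rmorphM.
  exists v => p; split=> [vp|/dvdpP[q ->]]; last first.
    rewrite vE mulrCA -Ef rmorphM /= Cayley_Hamilton mulr0; exact: row0.
  rewrite (eqp_dvdl _ Eh); apply/contraT; rewrite -irreducible_poly_coprime //.
  rewrite -(eqp_coprimepl _ Eh) => /Bezout_eq1_coprimepP[[u w] /= uw].
  case/eqP: wX; rewrite -/v -[v]mulmx1 -[1%:M]/(1 : 'M[F]_n.+1) -(rmorph1 (horner_mx X)).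
  rewrite -uw rmorphD mulmxDr.
  rewrite vE mulrCA -Ef [w * p]mulrC !rmorphM /= -!mulmxE mulmxA vp.
  by rewrite Cayley_Hamilton mulmx0 row0 mul0mx addr0.
have r0 : r != 0 by apply: contraNneq g0 => E; rewrite Eg E mul0r.
have [sr sh] : (1 < size r)%N /\ (1 < size h)%N.
  by split; [move: r0 r1; rewrite -size_poly_gt0; case: (size r) => [|[]] | exact: (fst hi)].
have Es : size g = (size r + size h).-1.
  by rewrite Eg size_mul //; exact: monic_neq0.
have rf : r %| f by apply: dvdp_trans gf; rewrite Eg dvdp_mulr.
have [|v1 v1P] := IHk h _ (dvdp_trans hg gf); first by lia.
have [|v2 v2P] := IHk r _ rf; first by lia.
have chr : coprimep r h.
  case/dvdpP: gf fsep => s ->.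
  by rewrite separable_mul Eg separable_mul => /and3P[_ /and3P[]].
exists (v1 + v2) => p; rewrite mulmxDl; split=> [vp|]; last first.
  rewrite Eg => rhp; have [/v2P-> /v1P->] : r %| p /\ h %| p.
    by split; apply: dvdp_trans rhp; [rewrite dvdp_mulr | rewrite dvdp_mull].
  by rewrite addr0.
(* Taking q = h kills the [v1] part and leaves r | p h, hence r | p; taking q = r gives h | p
   likewise. *)
have vpq q : v1 *m horner_mx X (p * q) + v2 *m horner_mx X (p * q) = 0.
  by rewrite rmorphM /= -mulmxE !mulmxA -mulmxDl vp mul0mx.
rewrite Eg Gauss_dvdp //; apply/andP; split.
  have := vpq h; have -> : v1 *m horner_mx X (p * h) = 0 by apply/v1P; rewrite dvdp_mull.
  by rewrite add0r => /v2P; rewrite Gauss_dvdpl.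
have := vpq r; have -> : v2 *m horner_mx X (p * r) = 0 by apply/v2P; rewrite dvdp_mull.
by rewrite addr0 => /v1P; rewrite Gauss_dvdpl // coprimep_sym.
Qed.

End Cyclic.

(** * Cyclic vectors, centralizers and similarity *)

Section Krylov.
Variables (F : fieldType) (L : closedFieldType) (iota : {rmorphism F -> L}).
Hypothesis algL : integralRange iota.
Local Notation ev := (ev iota).
Variables (n : nat).
Implicit Types (X Z : 'M[F]_n.+1) (f g h p q : {poly F}) (a b : L).

(* Row i of K is v X^i for a cyclic vector v. *)
Lemma krylov X : separable_poly (char_poly X) ->
  exists (v : 'rV_n.+1) (K : 'M_n.+1), K \in unitmx /\
    forall u, u *m K = v *m horner_mx X (rVpoly u).
Proof.
move=> fsep; have [v vP] := vector_of_annihilator algL fsep (dvdpp _).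
pose K : 'M[F]_n.+1 := lin1_mx (mulmx v \o horner_mx X \o rVpoly).
have KE u : u *m K = v *m horner_mx X (rVpoly u) by rewrite mul_rV_lin1.
exists v, K; split=> //; rewrite -row_free_unit -kermx_eq0; apply/eqP/row_matrixP => i.
have := congr1 (row i) (mulmx_ker K); rewrite row_mul KE !row0 => /vP fu.
rewrite -[LHS]rVpolyK; have [->|u0] := eqVneq (rVpoly (row i (kermx K))) 0.
  by rewrite linear0.
have := leq_trans (dvdp_leq u0 fu) (size_poly _ _).
by rewrite size_char_poly ltnn.
Qed.

Lemma krylov_eq X Z Z' v (K : 'M_n.+1) : K \in unitmx ->
  (forall u, u *m K = v *m horner_mx X (rVpoly u)) ->
  (forall p, v *m horner_mx X p *m Z = v *m horner_mx X p *m Z') -> Z = Z'.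
Proof.
move=> Ku KE ZZ'; apply: (can_inj (mulKmx Ku)); apply/row_matrixP => i.
by rewrite !row_mul rowE KE ZZ'.
Qed.

(** For a cyclic vector [v], v Z = v p(X) for some [p]. Since [Z] commutes with [X], it agrees with
    p(X) on all v q(X), which span the space. *)
Lemma centralizer_horner X Z : separable_poly (char_poly X) ->
  Z *m X = X *m Z -> exists2 p : {poly F}, (size p <= n.+1)%N & Z = horner_mx X p.
Proof.
move=> fsep ZX; have [v [K [Ku KE]]] := krylov fsep.
pose p := rVpoly (v *m Z *m invmx K).
have vZ : v *m Z = v *m horner_mx X p by rewrite -KE mulmxKV.
exists p; first exact: size_poly.
apply: (krylov_eq Ku KE) => q.
have ZqX : Z *m horner_mx X q = horner_mx X q *m Z.
  by rewrite -(horner_mx_intertwine q (esym ZX)).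
rewrite -mulmxA -ZqX mulmxA vZ -!mulmxA; congr (_ *m _).
exact: comm_horner_mx2.
Qed.

(** Both matrices have cyclic vectors with the same annihilator, so sending v' p(X') to v p(X) is a
    well-defined isomorphism that intertwines them. *)
Lemma similar_separable X X' : separable_poly (char_poly X) ->
  char_poly X' = char_poly X ->
  exists2 P, P \in unitmx & X' *m P = P *m X.
Proof.
move=> fsep EX; have fsep' := fsep; rewrite -EX in fsep'.
have [v [K [Ku KE]]] := krylov fsep; have [v' [K' [Ku' KE']]] := krylov fsep'.
exists (invmx K' *m K); first by rewrite unitmx_mul unitmx_inv Ku' Ku.
have PE p : v' *m horner_mx X' p *m (invmx K' *m K) = v *m horner_mx X p.
  have sp : (size (p %% char_poly X)%R <= n.+1)%N.
    rewrite -ltnS -(size_char_poly X) ltn_modp; exact: separable_poly_neq0.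
  rewrite -((horner_mx_eq iota (p %% char_poly X) p fsep).2); last first.
    by move=> a fa; rewrite ev_mod.
  rewrite -((horner_mx_eq iota (p %% char_poly X) p fsep').2); last first.
    by move=> a; rewrite EX => fa; rewrite ev_mod.
  rewrite -(poly_rV_K sp) -KE' -KE.
  by rewrite mulmxA mulmxK.
apply: (krylov_eq Ku' KE') => p.
rewrite mulmxA -[v' *m _ *m X']mulmxA.
have -> : horner_mx X' p *m X' = horner_mx X' (p * 'X) by rewrite rmorphM /= horner_mx_X.
rewrite PE [RHS]mulmxA PE -mulmxA; congr (_ *m _).
by rewrite rmorphM /= horner_mx_X.
Qed.

End Krylov.

(** * Alternating forms and symplectic bases *)

Section Symplectic.
Variable F : fieldType.

(* In every characteristic this says that B is skew-symmetric with zero diagonal. *)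
Definition alternating k (B : 'M[F]_k) := exists S, B = S - S^T.

Lemma alternating_tr k (B : 'M[F]_k) : alternating B -> B^T = - B.
Proof. by case=> S ->; rewrite linearB /= trmxK opprB. Qed.

(** The 1 by 1 matrix u S u^T equals its transpose u S^T u^T. *)
Lemma alternating_isotropic k (B : 'M[F]_k) (u : 'rV_k) :
  alternating B -> u *m B *m u^T = 0.
Proof.
case=> S ->; rewrite mulmxBr mulmxBl; apply/eqP; rewrite subr_eq0; apply/eqP.
have -> : u *m S^T *m u^T = (u *m S *m u^T)^T by rewrite !trmx_mul trmxK mulmxA.
by apply/matrixP => i j; rewrite !ord1 [RHS]mxE.
Qed.

Lemma alternating_congr k l (B : 'M[F]_k) (P : 'M[F]_(k, l)) :
  alternating B -> alternating (P^T *m B *m P).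
Proof.
case=> S ->; exists (P^T *m S *m P).
by rewrite !trmx_mul trmxK mulmxBr mulmxBl !mulmxA.
Qed.

(** An isotropic subspace of dimension k < m has an orthogonal of dimension at least 2m - k > k,
    which therefore contains a vector outside it; adjoining that vector keeps the subspace
    isotropic. *)
Lemma lagrangian m (B : 'M[F]_(m + m)) k : alternating B -> (k <= m)%N ->
  exists E : 'M[F]_(k, m + m), row_free E /\ E *m B *m E^T = 0.
Proof.
move=> altB; elim: k => [|k IHk] km.
  by exists 0; split; [rewrite /row_free mxrank0 | rewrite !mul0mx].
have [E [freeE EBE]] := IHk (ltnW km).
have [u] : exists u : 'rV_(m + m), (u <= kermx (B *m E^T))%MS && ~~ (u <= E)%MS.
  have /row_subPn[i ui] : ~~ (kermx (B *m E^T) <= E)%MS.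
    apply/negP => /mxrankS; rewrite mxrank_ker (eqP freeE).
    have := rank_leq_col (B *m E^T); lia.
  by exists (row i (kermx (B *m E^T))); rewrite row_sub ui.
move=> /andP[/sub_kermxP uBE uE]; rewrite mulmxA in uBE.
have EBu : E *m B *m u^T = 0.
  apply: (can_inj (@trmxK _ _ _)); rewrite !trmx_mul trmxK (alternating_tr altB).
  by rewrite mulNmx mulmxN mulmxA uBE oppr0 trmx0.
pose E' : 'M_(1 + k, m + m) := col_mx u E.
have E'BE' : E' *m B *m E'^T = 0.
  rewrite tr_col_mx mul_col_mx mul_col_row (alternating_isotropic _ altB) EBE EBu uBE.
  exact: block_mx0.
exists E'; split=> //.
rewrite -row_leq_rank; have -> : \rank E' = \rank (u + E)%MS.
  by have [-> _] := addsmxE u E.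
rewrite -{1}(eqP freeE); apply: rank_ltmx.
rewrite ltmxE addsmxSr; apply: contra uE; apply: submx_trans; exact: addsmxSl.
Qed.

End Symplectic.

Lemma sympJ_unit (F : finFieldType) m : sympJ F m \in unitmx.
Proof.
suff : sympJ F m *m - sympJ F m = 1%:M by move/mulmx1_unit => [].
rewrite mulmxN mulmx_block !mul0mx !mulmx0 !mulNmx !mulmxN !mul1mx.
by rewrite !add0r !addr0 opp_block_mx !oppr0 !opprK -scalar_mx_block.
Qed.

Lemma sympJ_alternating (F : finFieldType) m : alternating (sympJ F m).
Proof.
exists (block_mx 0 1%:M 0 0).
by rewrite tr_block_mx !trmx0 trmx1 opp_block_mx add_block_mx !oppr0 !addr0 !add0r.
Qed.

(** A Lagrangian [E] is completed by a dual family [G0]. If G0 B G0^T = S - S^T, then [G0 - S *m E]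
    is still dual to [E] and is isotropic too, so both families together have Gram matrix
    [sympJ]. *)
Lemma symplectic_basis (F : finFieldType) m (B : 'M[F]_(m + m)) :
  alternating B -> B \in unitmx -> exists P, P^T *m sympJ F m *m P = B.
Proof.
move=> altB Bu; have [E [freeE EBE]] := lagrangian altB (leqnn m).
have /row_freeP[R ER] := freeE.
pose G0 := (invmx B *m R)^T.
have EBG0 : E *m B *m G0^T = 1%:M by rewrite trmxK mulmxA mulmxK.
have [S ES] := alternating_congr G0^T altB; rewrite trmxK in ES.
have G0BE : G0 *m B *m E^T = - 1%:M.
  apply: (can_inj (@trmxK _ _ _)); rewrite linearN /= trmx1 -EBG0.
  by rewrite !trmx_mul trmxK (alternating_tr altB) mulNmx mulmxN !mulmxA.
pose G := G0 - S *m E.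
have EBG : E *m B *m G^T = 1%:M.
  by rewrite linearB /= trmx_mul mulmxBr EBG0 mulmxA EBE mul0mx subr0.
have GBE : G *m B *m E^T = - 1%:M.
  apply: (can_inj (@trmxK _ _ _)); rewrite linearN /= trmx1 -EBG.
  by rewrite !trmx_mul trmxK (alternating_tr altB) mulNmx mulmxN !mulmxA.
have GBG0 : G *m B *m G0^T = - S^T.
  rewrite /G !mulmxBl ES -!mulmxA [E *m _]mulmxA EBG0 mulmx1.
  by rewrite addrAC subrr add0r.
have GBG : G *m B *m G^T = 0.
  rewrite {2}/G linearB /= trmx_mul mulmxBr GBG0 mulmxA GBE.
  by rewrite mulNmx mul1mx opprK addNr.
pose Q := col_mx E G.
have QBQ : Q *m B *m Q^T = sympJ F m.
  by rewrite tr_col_mx mul_col_mx mul_col_row EBE EBG GBE GBG.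
have Qu : Q \in unitmx by move: (sympJ_unit F m); rewrite -QBQ !unitmx_mul => /andP[/andP[]].
exists (invmx Q)^T; rewrite trmxK -QBQ -!mulmxA -trmx_mul mulVmx // trmx1 mulmx1.
by rewrite !mulmxA mulVmx // mul1mx.
Qed.

(** * Invariant alternating forms *)

Lemma horner_mx_eigen (R : comNzRingType) n k (A : 'M[R]_n.+1) (E : 'M_(n.+1, k)) c p :
  A *m E = c *: E -> horner_mx A p *m E = p.[c] *: E.
Proof.
move=> AE; elim/poly_ind: p => [|p d IHp].
  by rewrite rmorph0 mul0mx horner0 scale0r.
rewrite rmorphD rmorphM /= horner_mx_X horner_mx_C mulmxDl -mulmxE -mulmxA AE.
by rewrite -scalemxAr IHp mul_scalar_mx hornerMXaddC scalerDl scalerA mulrC.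
Qed.

Lemma horner_mx_comp (R : comNzRingType) n (A : 'M[R]_n.+1) p q :
  horner_mx (horner_mx A q) p = horner_mx A (p \Po q).
Proof.
elim/poly_ind: p => [|p c IHp]; first by rewrite comp_poly0 !rmorph0.
by rewrite comp_poly_MXaddC !rmorphD !rmorphM /= IHp horner_mx_X !horner_mx_C.
Qed.

Lemma char_poly_tr (R : comNzRingType) n (A : 'M[R]_n) : char_poly A^T = char_poly A.
Proof.
rewrite /char_poly -det_tr; congr (\det _).
by rewrite /char_poly_mx linearB /= tr_scalar_mx map_trmx trmxK.
Qed.

Section InvariantForms.
Variables (F : fieldType) (L : closedFieldType) (iota : {rmorphism F -> L}).
Hypothesis algL : integralRange iota.
Local Notation ev := (ev iota).
Implicit Types (f g h p q : {poly F}) (a b : L).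

Definition inv_closed f := forall a, ev a f = 0 -> a != 0 /\ ev a^-1 f = 0.

(** Inversion acts on the roots without fixed points. As 0^-1 = 0 here, exactly the roots 0, 1 and
    -1 are excluded. *)
Definition unramified f := forall a, ev a f = 0 -> a != a^-1.

Variables (n : nat).
Implicit Types (X Z B : 'M[F]_n.+1).

Definition preserves X B := X^T *m B *m X = B.

Lemma preserves_unit X B : B \in unitmx -> preserves X B -> X \in unitmx.
Proof. by move=> Bu XB; move: Bu; rewrite -XB !unitmx_mul => /andP[]. Qed.

(** If v X = a v, then v B^-1 is an eigenvector of X^T for 1/a, and X^T has the characteristic
    polynomial of [X]. *)
Lemma preserves_inv_closed X B : B \in unitmx -> preserves X B ->
  inv_closed (char_poly X).
Proof.
move=> Bu XB a fa; have [v v0 vX] := eigenvector_ev fa.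
have Xu := preserves_unit Bu XB.
have a0 : a != 0.
  apply: contraNneq v0 => a0; move: vX; rewrite a0 scale0r => vX.
  by rewrite -[v](mulmxK (_ : map_mx iota X \in unitmx)) ?map_unitmx // vX mul0mx.
split=> //; rewrite -char_poly_tr evE map_char_poly; apply/rootP.
rewrite -eigenvalue_root_char; apply/eigenvalueP.
have BLu : map_mx iota B \in unitmx by rewrite map_unitmx.
exists (v *m invmx (map_mx iota B)); last first.
  apply: contraNneq v0 => vB.
  by rewrite -[v](mulmxKV BLu) vB mul0mx.
have XuL : map_mx iota X \in unitmx by rewrite map_unitmx.
apply: (can_inj (mulmxK BLu)); apply: (can_inj (mulmxK XuL)).
rewrite -scalemxAl mulmxKV // -scalemxAl vX scalerA mulVf // scale1r.
have /(congr1 (map_mx iota)) : X^T *m B *m X = B by [].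
by rewrite !map_mxM -!mulmxA => ->; rewrite mulVmx // mulmx1.
Qed.

Section Separable.
Variable X : 'M[F]_n.+1.
Local Notation f := (char_poly X).
Hypothesis fsep : separable_poly f.
Variable y : {poly F}.
Hypothesis yP : forall a, ev a f = 0 -> ev a y = a^-1.
Hypothesis f0 : forall a, ev a f = 0 -> a != 0.

Lemma horner_inv : X *m horner_mx X y = 1%:M.
Proof.
rewrite -{1}(horner_mx_X X) mulmxE -rmorphM /= -[RHS]/(1 : 'M_n.+1) -(rmorph1 (horner_mx X)).
apply/(horner_mx_eq iota) => // a fa.
by rewrite rmorphM rmorph1 /= evX yP // mulfV // f0.
Qed.

(** Invariance gives X^T B = B X^-1, and X^-1 = y(X). *)
Lemma horner_adjoint B p : preserves X B ->
  (horner_mx X p)^T *m B = B *m horner_mx X (p \Po y).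
Proof.
move=> XB; rewrite trmx_horner -horner_mx_comp.
apply: horner_mx_intertwine; rewrite -{2}XB -[RHS]mulmxA horner_inv mulmx1 //.
Qed.

End Separable.

(* If c = 1/c is a root then f = (x - c) g, and e = g(X) has rank one and
   satisfies e^T B e = g(c) B e; the left-hand side vanishes as B is alternating. *)
Lemma preserves_unramified X B : separable_poly (char_poly X) ->
  B \in unitmx -> alternating B -> preserves X B -> unramified (char_poly X).
Proof.
set f := char_poly X => fsep Bu altB XB a fa; apply/eqP => aV.
have [a0 _] := preserves_inv_closed Bu XB fa.
have [c ac cc] := self_inverse_rational iota a0 aV.
have /factor_theorem[g Ef] : root f c.
  by rewrite -(fmorph_root iota) -ac; apply/rootP.
have gc : g.[c] != 0.
  move: fsep; rewrite Ef separable_mul coprimep_sym => /and3P[_ _ cg].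
  by apply: (coprimep_root cg); rewrite root_XsubC.
have Xe : X *m horner_mx X g = c *: horner_mx X g.
  apply/eqP; rewrite -subr_eq0 -mul_scalar_mx -mulmxBl.
  rewrite -{1}(horner_mx_X X) -(horner_mx_C X) -rmorphB mulmxE -rmorphM /= mulrC -Ef.
  by rewrite Cayley_Hamilton.
set e := horner_mx X g in Xe.
have e0 : e != 0.
  apply/eqP => /(horner_mx_eq0 iota _ fsep); rewrite -/f Ef => /dvdp_leq.
  have g0 : g != 0 by apply: contraNneq gc => ->; rewrite horner0.
  by move=> /(_ g0); rewrite size_mul ?polyXsubC_eq0 // size_XsubC addn2 ltnn.
have [v [K [Ku KE]]] := krylov algL fsep.
(* Row i of [K] is v X^i and X e = c e, so row i of K e is c^i v e. Hence [e] is the column [b]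
   times the row v e. *)
pose b := invmx K *m \col_i (rVpoly (delta_mx 0 i : 'rV_n.+1)).[c].
have Eeb : e = b *m (v *m e).
  rewrite -mulmxA; apply: (can_inj (mulKmx Ku)); rewrite mulKVmx //.
  apply/row_matrixP => i; rewrite !row_mul rowE KE -mulmxA (horner_mx_eigen _ Xe).
  rewrite -scalemxAr; apply/rowP => j; rewrite !mxE big_ord1 !mxE.
  by congr (_.[_] * _).
clearbody b.
have XBe : X^T *m (B *m e) = c *: (B *m e).
  have := congr1 (mulmx^~ e) XB; rewrite -!mulmxA Xe -!scalemxAr => XBe.
  by rewrite -[in RHS]XBe scalerA cc scale1r.
have eBe : e^T *m (B *m e) = g.[c] *: (B *m e).
  by rewrite trmx_horner; apply: horner_mx_eigen.
case/eqP: e0; apply: (can_inj (mulKmx Bu)); rewrite mulmx0.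
apply/eqP; move/eqP: eBe; rewrite eq_sym => /eqP eBe.
have : g.[c] *: (B *m e) = 0.
  have bBb := alternating_isotropic b^T altB; rewrite trmxK in bBb.
  rewrite eBe Eeb; move: (v *m e) => w.
  rewrite trmx_mul -!mulmxA [B *m _]mulmxA [b^T *m _]mulmxA [b^T *m _]mulmxA.
  by rewrite bBb mul0mx mulmx0.
by move/eqP; rewrite scaler_eq0 (negPf gc).
Qed.

Lemma char_poly_invmx X : separable_poly (char_poly X) -> inv_closed (char_poly X) ->
  X \in unitmx -> char_poly (invmx X) = char_poly X.
Proof.
move=> fsep fV Xu; apply/eqP; rewrite -eqp_monic ?char_poly_monic // eqp_sym.
rewrite -dvdp_size_eqp ?size_char_poly //; apply: (sep_dvd (iota := iota) fsep) => a fa.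
have [a0 /eigenvector_ev[v v0 vX]] := fV _ fa.
rewrite evE map_char_poly; apply/rootP; rewrite -eigenvalue_root_char.
apply/eigenvalueP; exists v => //; rewrite map_invmx.
have XuL : map_mx iota X \in unitmx by rewrite map_unitmx.
apply: (can_inj (mulmxK XuL)); rewrite mulmxKV // -scalemxAl vX.
by rewrite scalerA mulfV // scale1r.
Qed.

(* X and its inverse transpose are similar, which gives an invariant bilinear
   form P with P^T = P c(X). Replacing P by its alternating part
   P W - (P W)^T = P (W - W(1/x) c) keeps it nondegenerate if W is 1 at the
   roots where c is not 1, and x at the others. *)
Lemma alternating_form_exists X : separable_poly (char_poly X) ->
  inv_closed (char_poly X) -> unramified (char_poly X) ->
  exists B, [/\ alternating B, B \in unitmx & preserves X B].
Proof.
set f := char_poly X => fsep fV fU.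
have f0 a : ev a f = 0 -> a != 0 by case/fV.
have [y yP] := ev_invX f0.
have Xu : X \in unitmx by have [] := mulmx1_unit (horner_inv fsep yP f0).
have [|P Pu PX] := @similar_separable _ _ _ algL _ X (invmx X^T) fsep.
  by rewrite -trmx_inv char_poly_tr char_poly_invmx.
have XTu : X^T \in unitmx by rewrite unitmx_tr.
have XP : preserves X P by rewrite /preserves -mulmxA -PX mulKVmx.
have XPT : preserves X P^T.
  by rewrite /preserves -{2}XP !trmx_mul trmxK mulmxA.
have [|c _ Ec] := @centralizer_horner _ _ _ algL _ X (invmx P *m P^T) fsep.
  apply: (can_inj (mulKmx Pu)); rewrite !mulmxA mulmxV // mul1mx.
  apply: (can_inj (mulKmx XTu)); rewrite !mulmxA XPT XP mulmxV // mul1mx //.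
have PT : P^T = P *m horner_mx X c by rewrite -Ec mulKVmx.
(* Transposing P^T = P c(X) gives P = P c(1/X) c(X), hence c(1/a) c(a) = 1 at each root. *)
have PE : P = P *m horner_mx X ((c \Po y) * c).
  have {1}-> : P = (P *m horner_mx X c)^T by rewrite -PT trmxK.
  rewrite trmx_mul PT mulmxA (horner_adjoint fsep yP f0) //.
  by rewrite -mulmxA mulmxE -rmorphM.
have cV a : ev a f = 0 -> ev a^-1 c * ev a c = 1.
  move=> fa; rewrite -(yP a fa) -ev_comp -rmorphM /= -(rmorph1 (ev a)).
  apply: (horner_mx_eq iota _ _ fsep).1 fa.
  by apply: (can_inj (mulKmx Pu)); rewrite -PE rmorph1 mulmx1.
(* [d] carries the roots where [c] is 1 and [e] the others; [r], glued by the Chinese remainder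
   theorem, is the polynomial W. *)
pose d := gcdp f (1 - c); pose e := f %/ d.
have Ef : f = e * d by rewrite divpK // dvdp_gcdl.
have dP a : ev a d = 0 <-> ev a f = 0 /\ ev a c = 1.
  split=> [da|[fa ca]].
    split; first exact: (ev_dvd (dvdp_gcdl _ _) da).
    have := ev_dvd (dvdp_gcdr _ _) da; rewrite rmorphB rmorph1 /= => /eqP.
    by rewrite subr_eq0 eq_sym => /eqP.
  apply/rootP; rewrite -[map_poly _ _]/(map_poly iota d).
  by rewrite gcdp_map root_gcd /root -!evE fa rmorphB rmorph1 /= ca subrr eqxx.
have [|r [rd re]] := @crt _ _ iota d e 'X 1.
  by move: fsep; rewrite -/f Ef separable_mul coprimep_sym => /and3P[].
have rP a : ev a f = 0 -> ev a r = if ev a c == 1 then a else 1.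
  move=> fa; case: eqP => ca; first by rewrite rd ?evX //; apply/dP.
  rewrite re ?rmorph1 //; move/eqP: (fa); rewrite Ef rmorphM mulf_eq0 => /orP[/eqP//|/eqP].
  by move=> /dP[].
exists (P *m horner_mx X (r - (r \Po y) * c)); split.
- exists (P *m horner_mx X r); rewrite trmx_mul PT mulmxA (horner_adjoint fsep yP f0) //.
  by rewrite -mulmxA mulmxE -rmorphM -mulmxBr -rmorphB.
- rewrite unitmx_mul Pu; apply/(horner_mx_unit iota)/(coprimep_evP iota) => a fa.
  have [a0 faV] := fV _ fa.
  (* Since c(1/a) = 1/c(a), the roots [a] and 1/a lie on the same side of the case distinction: the
     value is a - 1/a where c(a) = 1 and 1 - c(a) elsewhere. *)
  rewrite rmorphB rmorphM /= ev_comp yP // !rP //.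
  have cVa := cV _ fa; have ca0 : ev a c != 0.
    by apply: contra_eq_neq cVa => ->; rewrite mulr0 eq_sym oner_eq0.
  have -> : ev a^-1 c = (ev a c)^-1 by apply: (mulIf ca0); rewrite cVa mulVf.
  rewrite invr_eq1; case: (ev a c =P 1) => [->|/eqP ca].
    by rewrite mulr1 subr_eq0 fU.
  by rewrite mul1r subr_eq0 eq_sym.
set s := r - _; rewrite /preserves mulmxA -[X in _ *m X = _]horner_mx_X.
rewrite -mulmxA mulmxE -rmorphM mulrC rmorphM /= horner_mx_X -mulmxE mulmxA.
by rewrite [X^T *m P *m _ ]XP.
Qed.

End InvariantForms.

(** * Counting isometries with a given characteristic polynomial *)

Lemma card_constant_fibers (aT rT : finType) (h : aT -> rT) (A : {set aT})
    (D : {set rT}) k :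
  {in A, forall x, h x \in D} ->
  {in D, forall y, #|[set x in A | h x == y]| = k} -> #|A| = (#|D| * k)%N.
Proof.
move=> hAD hk; rewrite -sum1_card (partition_big h (mem D)) //=.
rewrite (eq_bigr (fun=> k)) ?sum_nat_const // => y Dy.
by rewrite -(hk y Dy) -sum1_card; apply: eq_bigl => x; rewrite inE.
Qed.

Lemma char_poly_similar (R : fieldType) n (A X P : 'M[R]_n) :
  P \in unitmx -> A *m P = P *m X -> char_poly A = char_poly X.
Proof.
move=> Pu AP; have P0 : \det (map_mx polyC P) != 0.
  by rewrite det_map_mx polyC_eq0 -unitfE -unitmxE.
apply: (mulIf P0); rewrite [RHS]mulrC -!det_mulmx; congr (\det _).
by rewrite mulmxBl mulmxBr -!map_mxM AP scalar_mxC.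
Qed.

Section LocalCount.
Variables (F : finFieldType) (L : closedFieldType) (iota : {rmorphism F -> L}).
Hypothesis algL : integralRange iota.
Local Notation ev := (ev iota).
Local Notation inv_closed := (inv_closed iota).
Local Notation unramified := (unramified iota).
Implicit Types (f g h p q : {poly F}) (a b : L).

(* The residues mod f are represented by their reduced representatives, and a
   condition on a residue by a condition at each root of f. *)
Definition local_set k (Q : L -> {poly F} -> Prop) f : {set 'rV[F]_k} :=
  [set v | `[< forall a, ev a f = 0 -> Q a (rVpoly v) >] ].

Definition local_count Q f := #|local_set (size f).-1 Q f|.

Definition unit_at a p := ev a p != 0.
Definition fixed_at a p := ev a^-1 p = ev a p.
Definition fixed_unit_at a p := unit_at a p /\ fixed_at a p.

Lemma local_countE k Q f : (size f).-1 = k -> local_count Q f = #|local_set k Q f|.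
Proof. by move=> <-. Qed.

Section FixedCharPoly.
Variables (n : nat) (X : 'M[F]_n.+1).
Local Notation f := (char_poly X).
Hypothesis fsep : separable_poly f.

Lemma horner_rVpoly_inj_sep :
  injective (fun v : 'rV_n.+1 => horner_mx X (rVpoly v)).
Proof.
move=> u v /(horner_mx_eq iota _ _ fsep) uv; apply: (can_inj rVpolyK).
apply/eqP; rewrite -subr_eq0; apply: contraT => d0.
have := leq_trans (dvdp_leq d0 (sep_dvd (iota := iota) fsep _)) (size_polyD _ _).
rewrite size_char_poly size_polyN => H.
have /H : forall a, ev a f = 0 -> ev a (rVpoly u - rVpoly v) = 0.
  by move=> a fa; rewrite rmorphB /= uv // subrr.
by rewrite leqNgt ltnS geq_max !size_poly.
Qed.

Lemma card_centralizer :
  #|[set Z : 'M[F]_n.+1 | (Z \in unitmx) && (Z *m X == X *m Z)]| = local_count unit_at f.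
Proof.
rewrite (@local_countE n.+1) ?size_char_poly //.
rewrite -(card_imset _ horner_rVpoly_inj_sep); congr #|pred_of_set _|; apply/setP => Z.
rewrite inE; apply/andP/imsetP => [[Zu /eqP ZX]|[v]].
  have [p sp Zp] := centralizer_horner algL fsep ZX.
  exists (poly_rV p); last by rewrite poly_rV_K.
  rewrite inE poly_rV_K //; apply/asboolP; apply/(coprimep_evP iota).
  by apply/(horner_mx_unit iota); rewrite -Zp.
rewrite inE => /asboolP/(coprimep_evP iota)/(horner_mx_unit iota) vu ->.
split=> //; apply/eqP; rewrite -{2 3}(horner_mx_X X); exact: comm_horner_mx2.
Qed.

(** Fix one form [B0]. Invariance of [B] makes B0^-1 B commute with [X], so B = B0 p(X), and
    skew-symmetry says that [p] is fixed by x -> 1/x. The converse writes [p] as a trace, because in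
    characteristic 2 skew-symmetry does not give a zero diagonal. *)
Lemma card_invariant_forms : inv_closed f -> unramified f ->
  #|[set B : 'M[F]_n.+1 | `[< [/\ alternating B, B \in unitmx & preserves X B] >] ]|
    = local_count fixed_unit_at f.
Proof.
move=> fV fU; have [B0 [altB0 B0u XB0]] := alternating_form_exists algL fsep fV fU.
have f0 a : ev a f = 0 -> a != 0 by case/fV.
have [y yP] := ev_invX f0.
have Xu : X \in unitmx by have [] := mulmx1_unit (horner_inv fsep yP f0).
have XTu : X^T \in unitmx by rewrite unitmx_tr.
have inj : injective (fun v : 'rV_n.+1 => B0 *m horner_mx X (rVpoly v)).
  by move=> u v /(can_inj (mulKmx B0u)) /horner_rVpoly_inj_sep.
rewrite (@local_countE n.+1) ?size_char_poly //.
rewrite -(card_imset _ inj); congr #|pred_of_set _|; apply/setP => B.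
rewrite inE; apply/asboolP/imsetP => [[altB Bu XB]|[v]].
  have [|p sp Ep] := @centralizer_horner _ _ _ algL _ X (invmx B0 *m B) fsep.
    apply: (can_inj (mulKmx B0u)); rewrite !mulmxA mulmxV // mul1mx.
    apply: (can_inj (mulKmx XTu)); rewrite !mulmxA XB XB0 mulmxV // mul1mx //.
  have EB : B = B0 *m horner_mx X p by rewrite -Ep mulKVmx.
  exists (poly_rV p); last by rewrite poly_rV_K.
  rewrite inE poly_rV_K //; apply/asboolP => a fa; split.
    apply: (coprimep_evP iota _ _ _ a fa); apply/(horner_mx_unit iota).
    by move: Bu; rewrite EB unitmx_mul => /andP[].
  rewrite /fixed_at -(yP a fa) -ev_comp; apply: (horner_mx_eq iota _ _ fsep).1 fa.
  apply: (can_inj (mulKmx B0u)); rewrite -(horner_adjoint fsep yP f0) // -EB.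
  apply: oppr_inj; rewrite -(alternating_tr altB) EB trmx_mul (alternating_tr altB0).
  by rewrite mulmxN.
rewrite inE => /asboolP vP ->.
set p := (X in horner_mx _ X); rewrite -[rVpoly v]/p in vP *.
have pV a : ev a f = 0 -> ev a^-1 p = ev a p by case/vP.
split.
(* -1 is its own inverse, hence not a root, so 1 + x has an inverse [t] modulo [f]. *)
- have f1 : coprimep (1 + 'X) f.
    apply/(coprimep_evP iota) => a fa; rewrite rmorphD rmorph1 /= evX addrC addr_eq0.
    by apply: contra (fU _ fa) => /eqP->; rewrite invrN invr1.
  have [t tP] := ev_inv iota f1.
  (* t(x) + t(1/x) = 1, so the fixed element p is the trace of p t. *)
  exists (B0 *m horner_mx X (p * t)).
  rewrite trmx_mul (alternating_tr altB0) mulmxN opprK (horner_adjoint fsep yP f0) //.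
  rewrite -mulmxDr -rmorphD; congr (_ *m _); apply/(horner_mx_eq iota) => // a fa.
  have [a0 faV] := fV _ fa.
  rewrite rmorphD /= ev_comp !rmorphM /= yP // !tP // pV // !rmorphD !rmorph1 /= !evX.
  rewrite -mulrDr -[LHS]mulr1; congr (_ * _).
  have a1 : 1 + a != 0.
    rewrite addrC addr_eq0.
    by apply: contra (fU _ fa) => /eqP->; rewrite invrN invr1.
  have -> : 1 + a^-1 = a^-1 * (1 + a) by rewrite mulrDr mulr1 mulVf // addrC.
  by rewrite invfM invrK -{1}[(1 + a)^-1]mul1r -mulrDl mulfV.
- rewrite unitmx_mul B0u; apply/(horner_mx_unit iota)/(coprimep_evP iota) => a fa.
  by have [] := vP _ fa.
rewrite /preserves mulmxA -[X in _ *m X = _]horner_mx_X.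
rewrite -mulmxA mulmxE -rmorphM mulrC rmorphM /= horner_mx_X -mulmxE mulmxA.
by rewrite [X^T *m B0 *m _ ]XB0.
Qed.

Variable J : 'M[F]_n.+1.
Hypotheses (Ju : J \in unitmx) (altJ : alternating J).
Hypothesis J_universal :
  forall B : 'M[F]_n.+1, alternating B -> B \in unitmx -> exists P, P^T *m J *m P = B.

(* Both sides count the invertible P with P X P^-1 preserving J, equivalently
   with X preserving P^T J P: by the matrix P X P^-1 on the left, by the form
   P^T J P on the right. *)
Lemma card_isometries_char_poly : inv_closed f -> unramified f ->
  (#|[set A : 'M[F]_n.+1 | (A^T *m J *m A == J) && (char_poly A == f)]|
     * local_count unit_at f =
   local_count fixed_unit_at f * #|[set A : 'M[F]_n.+1 | A^T *m J *m A == J]|)%N.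
Proof.
move=> fV fU; rewrite -card_invariant_forms // -card_centralizer.
set D1 := [set A | _ && (_ == f)]; set C := [set Z | _].
set D2 := [set B | _]; set Sp := [set A | _].
have SpU A : A \in Sp -> A \in unitmx.
  by rewrite inE => /eqP H; apply: (preserves_unit Ju H).
pose T := [set P in unitmx | P *m X *m invmx P \in Sp].
have TP P : P \in unitmx -> (P \in T) = (X^T *m (P^T *m J *m P) *m X == P^T *m J *m P).
  move=> Pu; rewrite !inE Pu /=; set A := P *m X *m _.
  have AP : A *m P = P *m X by rewrite mulmxKV.
  clearbody A.
  have PTu : P^T \in unitmx by rewrite unitmx_tr.
  have -> : X^T *m (P^T *m J *m P) *m X = P^T *m (A^T *m J *m A) *m P.
    have PTA : P^T *m A^T = X^T *m P^T by rewrite -!trmx_mul AP.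
    by rewrite !mulmxA PTA -!mulmxA AP.
  apply/eqP/eqP => [->//|H].
  by apply: (can_inj (mulKmx PTu)); apply: (can_inj (mulmxK Pu)).
have TU P : P \in T -> P \in unitmx by rewrite inE => /andP[].
transitivity #|T|.
  apply/esym/(@card_constant_fibers _ _ (fun P => P *m X *m invmx P)) => [P|A].
    move=> PT; have Pu := TU _ PT; move: PT; rewrite !inE => /andP[_ ->] /=.
    by apply/eqP; apply: (char_poly_similar Pu); rewrite mulmxKV.
  rewrite inE => /andP[ASp /eqP EA].
  have [P0 P0u AP0] := similar_separable algL fsep EA.
  (* The fibre over [A] is the coset P0 C, where [C] is the group of units of the centralizer of
     [X]. *)
  rewrite -(card_imset (f := fun Z => P0 *m Z) C (can_inj (mulKmx P0u))).
  congr #|pred_of_set _|; apply/setP => P; rewrite !inE.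
  apply/idP/imsetP => [|[Z]].
    move=> /andP[/andP[Pu _] /eqP EP].
    exists (invmx P0 *m P); last by rewrite mulKVmx.
    rewrite inE unitmx_mul unitmx_inv P0u Pu /=; apply/eqP.
    apply: (can_inj (mulKmx P0u)); rewrite !mulmxA mulmxV // mul1mx -AP0.
    by rewrite -[A *m P0 *m _]mulmxA mulmxA mulmxK // -EP mulmxKV.
  rewrite inE => /andP[Zu /eqP ZX] ->.
  have Pu : P0 *m Z \in unitmx by rewrite unitmx_mul P0u.
  have -> : P0 *m Z *m X *m invmx (P0 *m Z) = A.
    by apply: (can_inj (mulmxK Pu)); rewrite mulmxKV // [in RHS]mulmxA AP0 -!mulmxA ZX.
  by rewrite Pu eqxx ASp.
apply: (@card_constant_fibers _ _ (fun P => P^T *m J *m P)) => [P PT|B].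
  rewrite inE; apply/asboolP; have Pu := TU _ PT; split.
  - exact: alternating_congr.
  - by rewrite !unitmx_mul unitmx_tr Ju Pu.
  by move: PT; rewrite TP // => /eqP.
rewrite inE => /asboolP[altB Bu XB].
have [P0 EB] := J_universal altB Bu.
have P0u : P0 \in unitmx by move: Bu; rewrite -EB !unitmx_mul => /andP[].
have P0Tu : P0^T \in unitmx by rewrite unitmx_tr.
(* The fibre over [B] is the coset Sp P0. *)
rewrite -(card_imset (f := fun Z => Z *m P0) Sp (can_inj (mulmxK P0u))).
congr #|pred_of_set _|; apply/setP => P; rewrite [LHS]inE.
apply/andP/imsetP => [[PT /eqP EP]|[S SSp ->]].
  exists (P *m invmx P0); last by rewrite mulmxKV.
  rewrite inE; apply/eqP; apply: (can_inj (mulKmx P0Tu)); apply: (can_inj (mulmxK P0u)).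
  rewrite EB -EP trmx_mul -!mulmxA mulVmx // mulmx1 [P0^T *m _]mulmxA -trmx_mul mulVmx //.
  by rewrite trmx1 mul1mx mulmxA.
have Su := SpU _ SSp; move: (SSp); rewrite inE => /eqP ES.
have EB' : (S *m P0)^T *m J *m (S *m P0) = B.
  by rewrite trmx_mul -EB -{2}ES !mulmxA.
split; last by rewrite EB'.
have Pu : S *m P0 \in unitmx by rewrite unitmx_mul Su.
have PTu : (S *m P0)^T \in unitmx by rewrite unitmx_tr.
by rewrite TP // EB'; apply/eqP.
Qed.

End FixedCharPoly.
End LocalCount.

(** * Multiplicativity and evaluation of the local counts *)

Section Multiplicativity.
Variables (F : finFieldType) (L : closedFieldType) (iota : {rmorphism F -> L}).
Local Notation ev := (ev iota).
Local Notation inv_closed := (inv_closed iota).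
Local Notation unramified := (unramified iota).
Local Notation local_count := (local_count iota).
Local Notation local_set := (local_set iota).
Local Notation unit_at := (unit_at iota).
Local Notation fixed_at := (fixed_at iota).
Local Notation fixed_unit_at := (fixed_unit_at iota).
Implicit Types (f g h p q : {poly F}) (a b : L).

(** Such a condition depends only on values at the roots of [g], so it survives reduction modulo [g]
    and gluing of residues. *)
Definition residual (Q : L -> {poly F} -> Prop) g := forall p q,
  (forall a, ev a g = 0 -> ev a p = ev a q) -> forall a, ev a g = 0 -> Q a p -> Q a q.

Lemma residual_unit g : residual unit_at g.
Proof. by move=> p q pq a ga; rewrite /unit_at pq. Qed.

Lemma residual_fixed g : inv_closed g -> residual fixed_at g.
Proof.
by move=> gV p q pq a ga; have [_ ga'] := gV _ ga; rewrite /fixed_at !pq.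
Qed.

Lemma residual_fixed_unit g : inv_closed g -> residual fixed_unit_at g.
Proof.
move=> gV p q pq a ga [pu pf]; split; first exact: (residual_unit pq ga pu).
exact: (residual_fixed gV pq ga pf).
Qed.

Lemma size_rVpoly_lt f k (v : 'rV[F]_k) : f != 0 -> (size f).-1 = k ->
  (size (rVpoly v) < size f)%N.
Proof.
rewrite -size_poly_gt0 => f0 Ek; apply: (@leq_ltn_trans k); first exact: size_poly.
by rewrite -Ek prednK.
Qed.

Lemma size_modp_pred p f : f != 0 -> (size (p %% f)%R <= (size f).-1)%N.
Proof. by move=> f0; have := ltn_modpN0 p f0; case: (size f). Qed.

Lemma poly_eq_of_ev f p q : separable_poly f ->
  (size p < size f)%N -> (size q < size f)%N ->
  (forall a, ev a f = 0 -> ev a p = ev a q) -> p = q.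
Proof.
move=> fsep sp sq pq; apply/eqP; rewrite -subr_eq0; apply: contraT => d0.
have fd : f %| p - q.
  by apply: (sep_dvd (iota := iota) fsep) => a fa; rewrite rmorphB /= pq // subrr.
have := leq_trans (dvdp_leq d0 fd) (size_polyD _ _).
by rewrite size_polyN leqNgt gtn_max sp sq.
Qed.

(** Chinese remainder theorem: reduction modulo [g] and modulo [h] is a bijection on reduced
    representatives. *)
Lemma local_count_mul Q g h : separable_poly (g * h) ->
  residual Q g -> residual Q h ->
  local_count Q (g * h) = (local_count Q g * local_count Q h)%N.
Proof.
move=> ghsep Qg Qh; have := ghsep; rewrite separable_mul => /and3P[gsep hsep cgh].
have gh0 := separable_poly_neq0 ghsep.
have g0 := separable_poly_neq0 gsep; have h0 := separable_poly_neq0 hsep.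
rewrite /local_count -cardsX.
pose phi (v : 'rV[F]_(size (g * h)%R).-1) : 'rV[F]_(size g).-1 * 'rV[F]_(size h).-1 :=
  (poly_rV (rVpoly v %% g), poly_rV (rVpoly v %% h)).
have phi1 v : rVpoly (phi v).1 = rVpoly v %% g by rewrite poly_rV_K ?size_modp_pred.
have phi2 v : rVpoly (phi v).2 = rVpoly v %% h by rewrite poly_rV_K ?size_modp_pred.
have ghP a := ev_mul_eq0 iota a g h.
have phi_inj : injective phi.
  move=> u v uv; apply: (can_inj rVpolyK).
  apply: (poly_eq_of_ev ghsep); rewrite ?size_rVpoly_lt // => a /ghP[] ga.
    by rewrite -(ev_mod _ ga) -phi1 uv phi1 ev_mod.
  by rewrite -(ev_mod _ ga) -phi2 uv phi2 ev_mod.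
rewrite -(card_imset _ phi_inj); congr #|pred_of_set _|; apply/setP => -[v w].
rewrite in_setX; apply/imsetP/andP => [[u]|].
  rewrite inE => /asboolP uP Evw.
  rewrite -[v]/(v, w).1 -[w in X in _ /\ X]/(v, w).2 Evw !inE; split; apply/asboolP => a ga.
    rewrite phi1; apply: (Qg (rVpoly u)) => // [b gb|]; first by rewrite ev_mod.
    by apply: uP; apply/ghP; left.
  rewrite phi2; apply: (Qh (rVpoly u)) => // [b gb|]; first by rewrite ev_mod.
  by apply: uP; apply/ghP; right.
rewrite !inE => -[/asboolP vP /asboolP wP].
have [r [rg rh]] := crt iota (rVpoly v) (rVpoly w) cgh.
have Er : rVpoly (poly_rV (r %% (g * h)) : 'rV_(size (g * h)%R).-1) = r %% (g * h).
  by rewrite poly_rV_K ?size_modp_pred.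
exists (poly_rV (r %% (g * h))).
  rewrite inE Er; apply/asboolP => a /[dup] gha /ghP[] ga.
    apply: (Qg (rVpoly v)) => // [b gb|]; last exact: vP.
    by rewrite ev_mod ?rg //; apply/ghP; left.
  apply: (Qh (rVpoly w)) => // [b gb|]; last exact: wP.
  by rewrite ev_mod ?rh //; apply/ghP; right.
congr pair; apply: (can_inj rVpolyK).
  rewrite poly_rV_K ?size_modp_pred // Er; apply: (poly_eq_of_ev gsep).
  - exact: size_rVpoly_lt.
  - exact: ltn_modpN0.
  by move=> a ga; rewrite !ev_mod ?rg //; apply/ghP; left.
rewrite poly_rV_K ?size_modp_pred // Er; apply: (poly_eq_of_ev hsep).
- exact: size_rVpoly_lt.
- exact: ltn_modpN0.
by move=> a ga; rewrite !ev_mod ?rh //; apply/ghP; right.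
Qed.

Lemma card_units_irreducible g : irreducible_poly g ->
  local_count unit_at g = (#|F| ^ (size g).-1).-1.
Proof.
move=> gi; rewrite /local_count -[X in (_ ^ X)%N]mul1n -card_mx -(cardsC1 0).
congr #|pred_of_set _|; apply/setP => v; rewrite !inE; apply/asboolP/idP => [vP|v0 a ga].
  have [a ga] := ev_root_exists iota (fst gi).
  by apply: contraTneq (vP a ga) => ->; rewrite /unit_at linear0 rmorph0 eqxx.
apply: contraNneq v0 => va; rewrite -[v]rVpolyK.
have gv := irr_dvd gi ga va.
have [->|r0] := eqVneq (rVpoly v) 0; first by rewrite linear0.
by have := dvdp_leq r0 gv; rewrite leqNgt size_rVpoly_lt ?irredp_neq0.
Qed.

(* Each residue is uniquely u + x v with u and v fixed by x -> 1/x. *)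
Lemma card_fixed_sqr f : separable_poly f -> inv_closed f -> unramified f ->
  (local_count fixed_at f ^ 2 = #|F| ^ (size f).-1)%N.
Proof.
move=> fsep fV fU; rewrite -mulnn -cardsX -[X in (_ ^ X)%N]mul1n -card_mx -cardsT.
have fn0 := separable_poly_neq0 fsep.
have f0 a : ev a f = 0 -> a != 0 by case/fV.
have [y yP] := ev_invX f0.
set N := (size f).-1.
pose phi (u : 'rV[F]_N * 'rV[F]_N) : 'rV[F]_N :=
  poly_rV ((rVpoly u.1 + 'X * rVpoly u.2) %% f).
have phiE u a : ev a f = 0 -> ev a (rVpoly (phi u)) = ev a (rVpoly u.1) + a * ev a (rVpoly u.2).
  by move=> fa; rewrite poly_rV_K ?size_modp_pred // ev_mod // rmorphD rmorphM /= evX.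
set A := setX _ _.
have inj : {in A &, injective phi}.
  move=> [u1 u2] [v1 v2]; rewrite !inE /= => /andP[/asboolP u1P /asboolP u2P].
  move=> /andP[/asboolP v1P /asboolP v2P] uv.
  have E a : ev a f = 0 -> ev a (rVpoly u1) + a * ev a (rVpoly u2) =
      ev a (rVpoly v1) + a * ev a (rVpoly v2).
    by move=> fa; rewrite -(phiE (u1, u2)) // -(phiE (v1, v2)) // uv.
  (* Subtracting the equations at [a] and 1/a isolates (a - 1/a) times the second component, and a -
     1/a is nonzero. *)
  have E2 a : ev a f = 0 -> ev a (rVpoly u2) = ev a (rVpoly v2).
    move=> fa; have [_ fa'] := fV _ fa; have := E _ fa; have := E _ fa'.
    rewrite u1P // u2P // v1P // v2P // => H1 H2.
    apply/eqP; rewrite -subr_eq0; have := fU _ fa; rewrite -subr_eq0 => aU.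
    apply/eqP; apply: (mulfI aU); rewrite mulr0.
    have -> : (a - a^-1) * (ev a (rVpoly u2) - ev a (rVpoly v2)) =
      ((ev a (rVpoly u1) + a * ev a (rVpoly u2)) - (ev a (rVpoly v1) + a * ev a (rVpoly v2)))
      - ((ev a (rVpoly u1) + a^-1 * ev a (rVpoly u2))
         - (ev a (rVpoly v1) + a^-1 * ev a (rVpoly v2))).
      ring.
    by rewrite H1 H2 !subrr.
  congr pair; apply: (can_inj rVpolyK); apply: (poly_eq_of_ev fsep);
    rewrite ?size_rVpoly_lt // => a fa.
  by have := E _ fa; rewrite E2 // => /addIr.
rewrite -(card_in_imset inj); congr #|pred_of_set _|; apply/setP => v; rewrite inE.
apply/imsetP; pose p := rVpoly v.
have [w wP] : exists w, forall a, ev a f = 0 -> ev a w = (ev a ('X - y))^-1.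
  apply: ev_inv; apply/(coprimep_evP iota) => a fa.
  by rewrite rmorphB /= evX yP // subr_eq0 fU.
have {}wP a : ev a f = 0 -> ev a w = (a - a^-1)^-1.
  by move=> fa; rewrite wP // rmorphB /= evX yP.
(* Solving p = u1 + x u2 together with its image under inversion gives u2 = (p - p(1/x)) / (x -
   1/x). *)
pose u2 := ((p - (p \Po y)) * w) %% f; pose u1 := (p - 'X * u2) %% f.
have u2E a : ev a f = 0 -> ev a u2 = (ev a p - ev a^-1 p) / (a - a^-1).
  by move=> fa; rewrite ev_mod // rmorphM /= rmorphB /= ev_comp yP // wP.
have u1E a : ev a f = 0 -> ev a u1 = ev a p - a * ev a u2.
  by move=> fa; rewrite ev_mod // rmorphB rmorphM /= evX.
have u2F a : ev a f = 0 -> ev a^-1 u2 = ev a u2.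
  move=> fa; have [_ fa'] := fV _ fa; rewrite !u2E // invrK.
  by rewrite -[a^-1 - a]opprB invrN mulrN -mulNr opprB.
have [E1 E2] : rVpoly (poly_rV u1 : 'rV_N) = u1 /\ rVpoly (poly_rV u2 : 'rV_N) = u2.
  by rewrite !poly_rV_K ?size_modp_pred.
exists (poly_rV u1, poly_rV u2).
  rewrite !inE E1 E2; apply/andP; split; apply/asboolP => a fa; rewrite /fixed_at ?u2F //.
  have [a0 fa'] := fV _ fa; rewrite !u1E // u2F //.
  have Eu : (a - a^-1) * ev a u2 = ev a p - ev a^-1 p.
    by rewrite u2E // mulrC divfK // subr_eq0 fU.
  apply/eqP; rewrite -subr_eq0.
  rewrite (_ : _ - _ = (a - a^-1) * ev a u2 - (ev a p - ev a^-1 p)); last by ring.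
  by rewrite Eu subrr.
apply: (can_inj rVpolyK); apply: (poly_eq_of_ev fsep); rewrite ?size_rVpoly_lt // => a fa.
by rewrite phiE //= E1 E2 u1E // subrK.
Qed.

(** The last hypothesis makes the fixed ring a field: a fixed residue that vanishes at one root is
    zero. *)
Lemma card_fixed_units f : separable_poly f -> (1 < size f)%N ->
  (forall p a b, (forall c, ev c f = 0 -> fixed_at c p) ->
     ev a f = 0 -> ev b f = 0 -> ev a p = 0 -> ev b p = 0) ->
  local_count fixed_unit_at f = (local_count fixed_at f).-1.
Proof.
move=> fsep sf fP; rewrite /local_count.
have fn0 := separable_poly_neq0 fsep.
rewrite [in RHS](cardsD1 0) inE.
have -> : `[< forall a, ev a f = 0 -> fixed_at a (rVpoly (0 : 'rV_(size f).-1)) >].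
  by apply/asboolP => a _; rewrite /fixed_at linear0 !rmorph0.
rewrite add1n; congr #|pred_of_set _|; apply/setP => v; rewrite !inE.
apply/asboolP/andP => [vP|[v0 /asboolP vF a fa]].
  split; last by apply/asboolP => a /vP[].
  have [a fa] := ev_root_exists iota sf; have [vu _] := vP _ fa.
  by apply: contraTneq vu => ->; rewrite /unit_at linear0 rmorph0 eqxx.
split; last exact: vF.
apply: contraNneq v0 => va; rewrite -[v]rVpolyK.
rewrite (_ : rVpoly v = 0) ?linear0 //.
apply: (poly_eq_of_ev fsep); rewrite ?size_rVpoly_lt // ?size_poly0 ?(ltnW sf) // => b fb.
by rewrite rmorph0; apply: (fP _ a b).
Qed.

End Multiplicativity.

(** * Reciprocal polynomials and atoms *)

(** Translation by 1 permutes [F], so it preserves the sum of all elements, to which it adds #|F|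
    times 1. *)
Lemma card_natr_eq0 (F : finFieldType) : #|F|%:R = 0 :> F.
Proof.
have : \sum_(x : F) x = \sum_(x : F) (x + 1).
  by rewrite (reindex_inj (addIr 1)).
rewrite big_split /= sumr_const => /eqP.
by rewrite -{1}[\sum_x x]addr0 (inj_eq (addrI _)) eq_sym => /eqP.
Qed.

Lemma even_size_involution (T : eqType) (h : T -> T) (s : seq T) :
  uniq s -> {in s, forall x, [/\ h x \in s, h x != x & h (h x) = x]} -> ~~ odd (size s).
Proof.
have [k] := ubnP (size s); elim: k s => // k IHk [//|x s]; rewrite ltnS => sk.
move=> /andP[xs us] hP; have [hx hxx hhx] := hP x (mem_head _ _).
have hxs : h x \in s by move: hx; rewrite inE (negPf hxx).
rewrite /= negbK; have := size_rem hxs; have : (0 < size s)%N by case: (s) hxs.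
case Es: (size s) => [//|j] _ /= Er; rewrite -Er; apply: IHk.
- by rewrite Er; move: sk; rewrite /= Es => /ltnW.
- exact: rem_uniq.
move=> z; rewrite (mem_rem_uniq _ us) inE => /andP[zhx zs].
have [hz hzz hhz] := hP z (mem_behead (s := x :: s) zs).
split=> //; rewrite (mem_rem_uniq _ us) inE; apply/andP; split.
  by apply: contraNneq xs => /(congr1 h); rewrite hhz hhx => <-.
by move: hz; rewrite inE => /orP[/eqP hzx|//]; case/eqP: zhx; rewrite -hzx hhz.
Qed.

Section Reciprocal.
Variables (F : finFieldType) (L : closedFieldType) (iota : {rmorphism F -> L}).
Hypothesis algL : integralRange iota.
Local Notation ev := (ev iota).
Local Notation inv_closed := (inv_closed iota).
Local Notation unramified := (unramified iota).
Implicit Types (f g h p q : {poly F}) (a b : L).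

Lemma ev_rev f a : a != 0 -> ev a (Poly (rev f)) = a ^+ (size f).-1 * ev a^-1 f.
Proof.
move=> a0; rewrite !evE.
rewrite (@horner_coef_wide _ (size f)); last first.
  by rewrite size_map_poly; apply: leq_trans (size_Poly _) _; rewrite size_rev.
rewrite (@horner_coef_wide _ (size f)) ?size_map_poly // mulr_sumr.
rewrite (reindex_inj rev_ord_inj) /=; apply: eq_bigr => i _.
rewrite !coef_map coef_Poly nth_rev ?ltn_ord //; last first.
  by rewrite /= ltn_subrL (leq_ltn_trans _ (ltn_ord i)).
have -> : (size f - (size f - i.+1).+1 = i)%N by rewrite subnSK // subKn // ltnW.
rewrite mulrCA; congr (_ * _); rewrite exprVn.
have -> : (size f).-1 = (size f - i.+1 + i)%N by case: i => i /=; lia.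
by rewrite exprD mulfK // expf_neq0.
Qed.

Lemma size_recip f : f`_0 != 0 -> size (recip f) = size f.
Proof.
move=> f0; rewrite size_scale ?invr_eq0 // (@PolyK _ 0) ?size_rev //.
case: (polyseq f) f0 => [|c s] /= c0; first by rewrite eqxx in c0.
by rewrite rev_cons last_rcons.
Qed.

Lemma recip_monic f : f`_0 != 0 -> recip f \is monic.
Proof.
move=> f0; have sf : (0 < size f)%N.
  by rewrite lt0n; apply: contraNneq f0 => s0; rewrite nth_default ?s0.
rewrite monicE /lead_coef size_recip // coefZ coef_Poly nth_rev ?prednK //.
by rewrite subnn mulVf.
Qed.

Lemma ev_recip f a : f`_0 != 0 -> a != 0 -> ev a (recip f) = 0 <-> ev a^-1 f = 0.
Proof.
move=> f0 a0; rewrite evZ ev_rev //; split=> [/eqP|->]; last by rewrite !mulr0.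
rewrite !mulf_eq0 fmorph_eq0 invr_eq0 (negPf f0) expf_eq0 (negPf a0) andbF.
by move/eqP.
Qed.

Lemma ev0_coef f : ev 0 f = iota f`_0.
Proof. by rewrite evE horner_coef0 coef_map. Qed.

Lemma coef0_neq0 f a : irreducible_poly f -> ev a f = 0 -> a != 0 -> f`_0 != 0.
Proof.
move=> fi fa a0; apply: contraNneq a0 => f0.
have fX : f %| 'X.
  by apply: (irr_dvd fi (a := 0) (iota := iota)); rewrite ?evX // ev0_coef f0 rmorph0.
by have := ev_dvd fX fa; rewrite evX => /eqP.
Qed.

Lemma irr_coef0 f : f \is monic -> irreducible_poly f -> f <> 'X -> f`_0 != 0.
Proof.
move=> fm fi /eqP fX; have [a fa] := ev_root_exists iota (fst fi).
exact: coef0_neq0 fi fa (ev_neq0 fi fa fm fX).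
Qed.

(** Substituting [r] is the embedding of F(a) into F(b), written on reduced representatives. As [F]
    is finite, degrees can then be compared through cardinalities. *)
Lemma ev_comp_inj g h a b r : irreducible_poly g -> ev a g = 0 ->
  h != 0 -> ev b h = 0 -> a = ev b r ->
  injective (fun v : 'rV[F]_(size g).-1 =>
    poly_rV ((rVpoly v \Po r) %% h) : 'rV[F]_(size h).-1).
Proof.
move=> gi ga h0 hb ab u v /(congr1 rVpoly); rewrite !poly_rV_K ?size_modp_pred //.
move=> /(congr1 (ev b)); rewrite !ev_mod // !ev_comp -ab => uv.
have gd : g %| rVpoly u - rVpoly v.
  by apply: (irr_dvd gi ga); rewrite rmorphB /= uv subrr.
apply: (can_inj rVpolyK); apply/eqP; rewrite -subr_eq0; apply: contraT => d0.
have := leq_trans (dvdp_leq d0 gd) (size_polyD _ _).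
by rewrite size_polyN leqNgt gtn_max !size_rVpoly_lt ?irredp_neq0.
Qed.

Lemma irr_size_le g h a b r : irreducible_poly g -> ev a g = 0 ->
  irreducible_poly h -> ev b h = 0 -> a = ev b r -> (size g <= size h)%N.
Proof.
move=> gi ga hi hb ab; have := leq_card _ (ev_comp_inj gi ga (irredp_neq0 hi) hb ab).
rewrite !card_mx !mul1n leq_exp2l ?finNzRing_gt1 //.
by have : (0 < size h)%N; [rewrite size_poly_gt0 irredp_neq0 | lia].
Qed.

(** The embedding of F(a) into F(b) is now onto, and a preimage of the class of x expresses [b] in
    terms of [a]. *)
Lemma irr_generates g h a b r : irreducible_poly g -> ev a g = 0 ->
  irreducible_poly h -> ev b h = 0 -> a = ev b r -> size g = size h ->
  exists p, b = ev a p.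
Proof.
move=> gi ga hi hb ab sgh.
have inj := ev_comp_inj gi ga (irredp_neq0 hi) hb ab.
have [|phi' _ phiK] := inj_card_bij inj; first by rewrite !card_mx sgh.
exists (rVpoly (phi' (poly_rV ('X %% h)))).
have /(congr1 rVpoly) := phiK (poly_rV ('X %% h)).
rewrite !poly_rV_K ?size_modp_pred ?irredp_neq0 //.
by move=> /(congr1 (ev b)); rewrite !ev_mod // ev_comp -ab evX.
Qed.

(* Multiplication by a nonzero root a permutes the nonzero elements of F(a), so
   that a is a root of x^N - 1 with N = |F(a)| - 1 prime to the characteristic. *)
Lemma irr_separable g : irreducible_poly g -> separable_poly g.
Proof.
move=> gi; have [a ga] := ev_root_exists iota (fst gi).
have g0 := irredp_neq0 gi.
have [a0|a0] := eqVneq a 0.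
  have gX : g %| 'X by apply: (irr_dvd gi ga); rewrite evX.
  apply: dvdp_separable gX _.
  by have := separable_prod_XsubC [:: 0 : F]; rewrite big_seq1 subr0.
pose k := (size g).-1; pose E (v : 'rV[F]_k) := ev a (rVpoly v).
have E0 v : (E v == 0) = (v == 0).
  apply/eqP/eqP => [Ev|->]; last by rewrite /E linear0 rmorph0.
  rewrite -[v]rVpolyK; have gv := irr_dvd gi ga Ev.
  have [->|v0] := eqVneq (rVpoly v) 0; first by rewrite linear0.
  by have := dvdp_leq v0 gv; rewrite leqNgt size_rVpoly_lt.
pose m (v : 'rV[F]_k) : 'rV[F]_k := poly_rV (('X * rVpoly v) %% g).
have Em v : E (m v) = a * E v.
  by rewrite /E poly_rV_K ?size_modp_pred // ev_mod // rmorphM /= evX.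
have m_inj : injective m.
  move=> u v uv; apply/eqP; rewrite -subr_eq0 -E0 /E linearB rmorphB /= subr_eq0.
  by apply/eqP; apply: (mulfI a0); rewrite -!Em uv.
have aN : a ^+ #|[set v : 'rV[F]_k | v != 0]| = 1.
  have P0 : \prod_(v : 'rV[F]_k | v != 0) E v != 0 by apply/prodf_neq0 => v; rewrite E0.
  apply: (mulIf P0); rewrite mul1r [RHS](reindex_inj m_inj) /=.
  rewrite [RHS](eq_bigl (fun v => v != 0)); last first.
    by move=> v; rewrite -E0 Em mulf_eq0 (negPf a0) E0.
  rewrite [RHS](eq_bigr (fun v => a * E v)) => [|v _]; last exact: Em.
  rewrite big_split /= prodr_const; congr (_ ^+ _ * _).
  by apply: eq_card => v; rewrite !inE.
set N := #|_| in aN.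
have gN : g %| 'X^N - 1.
  by apply: (irr_dvd gi ga); rewrite rmorphB rmorphXn rmorph1 /= evX aN subrr.
apply: dvdp_separable gN _; apply: separable_Xn_sub_1.
have -> : N = (#|{: 'rV[F]_k}|).-1 by rewrite -(cardsC1 0); apply: eq_card => v; rewrite !inE.
rewrite card_mx mul1n; have : (1 < size g)%N := fst gi.
case Ek: k => [|j] sg; first by move: Ek sg; rewrite /k; case: (size g) => [|[]].
rewrite -subn1 natrB ?expn_gt0 ?(ltnW (finNzRing_gt1 F)) //.
by rewrite natrX card_natr_eq0 expr0n /= sub0r oppr_eq0 oner_eq0.
Qed.

(** The minimal polynomial of 1/b, for a root [b] of [h], divides [recip h]; it has the same degree
    because [b] lies in F(1/b). *)
Lemma recip_irr h : h \is monic -> irreducible_poly h -> h <> 'X ->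
  irreducible_poly (recip h).
Proof.
move=> hm hi hX; have [b hb] := ev_root_exists iota (fst hi).
have h0 := irr_coef0 hm hi hX; have b0 := ev_neq0 hi hb hm (introN eqP hX).
have [g [gm gi gb]] := minpoly_exists algL b^-1.
have rb : ev b^-1 (recip h) = 0 by apply/ev_recip; rewrite ?invr_eq0 ?invrK.
have gr : g %| recip h := irr_dvd gi gb rb.
have [y yP] : exists y, forall a, ev a g = 0 -> ev a y = a^-1.
  apply: ev_invX => a ga; apply: (ev_neq0 gi ga gm).
  by apply: contraNneq b0 => gX; move: gb; rewrite gX evX => /eqP; rewrite invr_eq0.
have sg : (size h <= size g)%N.
  by apply: (irr_size_le (r := y) hi hb gi gb); rewrite yP // invrK.
have r0 : recip h != 0 by rewrite -size_poly_eq0 size_recip // size_poly_eq0 irredp_neq0.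
have : g %= recip h.
  rewrite -dvdp_size_eqp // eqn_leq dvdp_leq //= size_recip //.
by rewrite eqp_monic // ?recip_monic // => /eqP <-.
Qed.

Lemma recip_neqX h : h \is monic -> irreducible_poly h -> h <> 'X -> recip h <> 'X.
Proof.
move=> hm hi hX rX; have h0 := irr_coef0 hm hi hX.
have [b hb] := ev_root_exists iota (fst hi); have b0 := ev_neq0 hi hb hm (introN eqP hX).
have : ev b^-1 (recip h) = 0 by apply/ev_recip; rewrite ?invr_eq0 ?invrK.
by rewrite rX evX => /eqP; rewrite invr_eq0 (negPf b0).
Qed.

Lemma recip_involutive h : h \is monic -> irreducible_poly h -> h <> 'X ->
  recip (recip h) = h.
Proof.
move=> hm hi hX; have h0 := irr_coef0 hm hi hX.
have ri := recip_irr hm hi hX; have rX := recip_neqX hm hi hX.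
have r0 := irr_coef0 (recip_monic h0) ri rX.
have [b hb] := ev_root_exists iota (fst hi); have b0 := ev_neq0 hi hb hm (introN eqP hX).
apply: (irr_monic_eq (a := b) _ hi _ hm _ hb).
- exact: recip_irr (recip_monic h0) ri rX.
- exact: recip_monic.
by apply/ev_recip => //; apply/ev_recip; rewrite ?invr_eq0 ?invrK.
Qed.

Lemma recip_eq_of_root h b : h \is monic -> irreducible_poly h -> h <> 'X ->
  ev b h = 0 -> ev b^-1 h = 0 -> recip h = h.
Proof.
move=> hm hi hX hb hb'; have h0 := irr_coef0 hm hi hX.
apply: (irr_monic_eq (a := b) (recip_irr hm hi hX) hi (recip_monic h0) hm _ hb).
by apply/ev_recip => //; exact: ev_neq0 hi hb hm (introN eqP hX).
Qed.

End Reciprocal.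

(** * Norm-one power roots on a single atom *)

Section Atoms.
Variables (F : finFieldType) (L : closedFieldType) (iota : {rmorphism F -> L}).
Hypothesis algL : integralRange iota.
Local Notation ev := (ev iota).
Local Notation inv_closed := (inv_closed iota).
Local Notation unramified := (unramified iota).
Local Notation local_count := (local_count iota).
Local Notation unit_at := (unit_at iota).
Local Notation fixed_at := (fixed_at iota).
Local Notation fixed_unit_at := (fixed_unit_at iota).
Implicit Types (f g h p q : {poly F}) (a b : L).

(* p describes an M-th root of x in F[x]/f on which the adjoint x -> 1/x acts by
   inversion. *)
Definition norm1_root M f := exists p, forall a, ev a f = 0 ->
  ev a p ^+ M = a /\ ev a^-1 p * ev a p = 1.

Lemma norm1_root_dvd M f g : g %| f -> norm1_root M f -> norm1_root M g.
Proof. by move=> gf [p pP]; exists p => a /(ev_dvd gf) /pP. Qed.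

Lemma norm1_root_mul M g h : coprimep g h -> inv_closed g -> inv_closed h ->
  norm1_root M g -> norm1_root M h -> norm1_root M (g * h).
Proof.
move=> cgh gV hV [p pP] [q qP]; have [r [rg rh]] := crt iota p q cgh.
exists r => a /ev_mul_eq0[] ga.
  by have [_ ga'] := gV _ ga; rewrite !rg //; apply: pP.
by have [_ ha'] := hV _ ga; rewrite !rh //; apply: qP.
Qed.

Lemma inv_closed_mul g h : inv_closed g -> inv_closed h -> inv_closed (g * h).
Proof.
move=> gV hV a /ev_mul_eq0[/gV|/hV] [a0 ga]; split=> //; apply/ev_mul_eq0; by [left | right].
Qed.

Lemma irr_unramified f : irreducible_poly f -> (2 < size f)%N ->
  inv_closed f -> unramified f.
Proof.
move=> fi sf fV a fa; apply/eqP => aV; have [a0 _] := fV _ fa.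
have [c ac _] := self_inverse_rational iota a0 aV.
have : f %| 'X - c%:P by apply: (irr_dvd fi fa); rewrite rmorphB /= evX evC ac subrr.
move=> /dvdp_leq; rewrite polyXsubC_eq0 size_XsubC => /(_ isT).
by rewrite leqNgt sf.
Qed.

(** Each of [a] and p(a) is a polynomial in the other, so their minimal polynomials have equal
    degree. *)
Lemma power_factor M g a p : irreducible_poly g -> ev a g = 0 -> ev a p ^+ M = a ->
  exists h, [/\ h \is monic, irreducible_poly h, ev (ev a p) h = 0,
    size h = size g & h %| compXM M g].
Proof.
move=> gi ga paM; have [h [hm hi hb]] := minpoly_exists algL (ev a p).
have E : a = ev (ev a p) 'X^M by rewrite rmorphXn /= evX.
exists h; split=> //.
  apply/eqP; rewrite eqn_leq (irr_size_le hi hb gi ga (erefl _)) /=.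
  exact: irr_size_le gi ga hi hb E.
by apply: (irr_dvd hi hb); rewrite ev_comp -E.
Qed.

(** F(b^M) lies in F(b), and equality of the degrees makes the two fields equal. *)
Lemma power_root M g h b : irreducible_poly g -> irreducible_poly h ->
  size h = size g -> h %| compXM M g -> ev b h = 0 ->
  ev (b ^+ M) g = 0 /\ exists p, ev (b ^+ M) p = b.
Proof.
move=> gi hi sgh hg hb.
have gbM : ev (b ^+ M) g = 0.
  by have := ev_dvd hg hb; rewrite ev_comp rmorphXn /= evX.
split=> //; have [|p pP] := irr_generates gi gbM hi hb _ (esym sgh) (r := 'X^M).
  by rewrite rmorphXn /= evX.
by exists p.
Qed.

Lemma ev_power_irr M g a p : irreducible_poly g -> ev a g = 0 -> ev a p ^+ M = a ->
  forall b, ev b g = 0 -> ev b p ^+ M = b.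
Proof.
move=> gi ga paM b gb; apply/eqP; rewrite -subr_eq0; apply/eqP.
have gd : g %| p ^+ M - 'X.
  by apply: (irr_dvd gi ga); rewrite rmorphB rmorphXn /= evX paM subrr.
by have := ev_dvd gd gb; rewrite rmorphB rmorphXn /= evX.
Qed.

Section SelfReciprocal.
Variables (k : nat) (g : {poly F}).
Hypotheses (k_gt0 : (0 < k)%N) (gS : SRIM g) (sg : size g = k.*2.+1).

Let gm : g \is monic. Proof. by case: gS. Qed.
Let gi : irreducible_poly g. Proof. by case: gS. Qed.

Let gX : g <> 'X.
Proof. by move=> E; move: sg; rewrite E size_polyX; lia. Qed.

Lemma srim_inv_closed : inv_closed g.
Proof.
move=> a ga; have a0 := ev_neq0 gi ga gm (introN eqP gX).
have g0 := irr_coef0 iota gm gi gX.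
by split=> //; apply/(ev_recip iota g0 a0); case: gS => _ _ <-.
Qed.

Lemma srim_unramified : unramified g.
Proof. by apply: (irr_unramified gi _ srim_inv_closed); rewrite sg; lia. Qed.

Lemma srim_separable : separable_poly g.
Proof. exact: irr_separable iota _ gi. Qed.

Lemma srim_fixed_units : local_count fixed_unit_at g = (#|F| ^ k).-1.
Proof.
rewrite card_fixed_units ?srim_separable //; last 2 first.
- exact: (fst gi).
- by move=> p a b _ ga gb pa; apply: ev_dvd gb; apply: irr_dvd ga pa.
congr _.-1; have := card_fixed_sqr srim_separable srim_inv_closed srim_unramified.
by rewrite sg /= -muln2 expnM => /eqP; rewrite eqn_exp2r // => /eqP.
Qed.

Lemma srim_units : local_count unit_at g = (#|F| ^ k.*2).-1.
Proof. by rewrite card_units_irreducible // sg. Qed.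

(** Forward: b = p(a) has inverse p(1/a), a conjugate of b, so the minimal polynomial of b is
    self-reciprocal. Backward: a root b of [h] is p(b^M), and since 1/b is conjugate to b, also
    p(1/b^M) = 1/b. *)
Lemma srim_norm1_root M :
  norm1_root M g <-> exists h, [/\ SRIM h, size h = k.*2.+1 & h %| compXM M g].
Proof.
have [a ga] := ev_root_exists iota (fst gi).
split=> [[p pP]|[h [hS sh hg]]].
  have [paM pa1] := pP _ ga.
  have [h [hm hi hb sh hg]] := power_factor gi ga paM.
  exists h; split; rewrite ?sh //; split=> //; apply/esym.
  have b0 : ev a p != 0.
    by apply: contra_eq_neq pa1 => ->; rewrite mulr0 eq_sym oner_eq0.
  apply: (recip_eq_of_root algL hm hi _ hb).
    by move=> hX; move: hb b0; rewrite hX evX => ->; rewrite eqxx.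
  have -> : (ev a p)^-1 = ev a^-1 p by apply: (mulIf b0); rewrite mulVf.
  have [_ ga'] := srim_inv_closed ga.
  have gd : g %| h \Po p by apply: (irr_dvd gi ga); rewrite ev_comp.
  by rewrite -ev_comp; apply: ev_dvd gd ga'.
have [hm hi hr] := hS; have [b hb] := ev_root_exists iota (fst hi).
have [|gb [p pb]] := power_root gi hi _ hg hb; first by rewrite sg sh.
have hX : h <> 'X by move=> E; move: sh; rewrite E size_polyX; lia.
have b0 := ev_neq0 hi hb hm (introN eqP hX).
have h0 := irr_coef0 iota hm hi hX.
have hb' : ev b^-1 h = 0 by apply/(ev_recip iota h0 b0); rewrite -hr.
have gne a' : ev a' g = 0 -> a' != 0 by case/srim_inv_closed.
have [y yP] := ev_invX gne.
exists p => c gc; split; first by apply: (ev_power_irr gi gb) gc; rewrite pb.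
have gd : g %| (p \Po y) * p - 1.
  apply: (irr_dvd gi gb); rewrite rmorphB rmorphM rmorph1 /= ev_comp yP // pb.
  have hd : h %| (p \Po 'X^M) - 'X.
    by apply: (irr_dvd hi hb); rewrite rmorphB /= ev_comp rmorphXn /= evX pb subrr.
  have := ev_dvd hd hb'; rewrite rmorphB /= ev_comp rmorphXn /= evX exprVn.
  by move=> /eqP; rewrite subr_eq0 => /eqP->; rewrite mulVf // subrr.
have := ev_dvd gd gc; rewrite rmorphB rmorphM rmorph1 /= ev_comp yP // => /eqP.
by rewrite subr_eq0 => /eqP.
Qed.

End SelfReciprocal.

(* The polynomials phi <> phi^* of the definition of R^*_M. *)
Definition nonself d f :=
  [/\ f \is monic, irreducible_poly f, f <> 'X, size f = d.+1 & f <> recip f].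

Section ReciprocalPair.
Variables (d : nat) (f : {poly F}).
Hypothesis fN : nonself d f.

Let fm : f \is monic. Proof. by case: fN. Qed.
Let fi : irreducible_poly f. Proof. by case: fN. Qed.
Let fX : f <> 'X. Proof. by case: fN. Qed.
Let sf : size f = d.+1. Proof. by case: fN. Qed.
Let fr : f <> recip f. Proof. by case: fN. Qed.
Let f0 : f`_0 != 0. Proof. exact: (irr_coef0 iota). Qed.
Let ri : irreducible_poly (recip f). Proof. exact: (recip_irr algL). Qed.
Let rm : recip f \is monic. Proof. exact: recip_monic. Qed.
Let rX : recip f <> 'X. Proof. exact: (recip_neqX iota). Qed.

Lemma nonself_recip : nonself d (recip f).
Proof.
split=> //; first by rewrite size_recip.
by rewrite (recip_involutive algL) // => /esym.
Qed.

Lemma recip_root a : ev a (recip f) = 0 <-> a != 0 /\ ev a^-1 f = 0.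
Proof.
split=> [ra|[a0 fa]]; last exact/ev_recip.
have a0 := ev_neq0 ri ra rm (introN eqP rX).
by split=> //; apply/ev_recip.
Qed.

Lemma root_recip a : ev a f = 0 -> a != 0 /\ ev a^-1 (recip f) = 0.
Proof.
move=> fa; have a0 := ev_neq0 fi fa fm (introN eqP fX).
by split=> //; apply/recip_root; rewrite invr_eq0 invrK.
Qed.

Lemma pair_coprime : coprimep f (recip f).
Proof.
apply/(coprimep_evP iota) => a ra; apply/eqP => fa.
exact: fr (irr_monic_eq fi ri fm rm fa ra).
Qed.

Lemma pair_separable : separable_poly (f * recip f).
Proof. by rewrite separable_mul !(irr_separable iota) // pair_coprime. Qed.

Lemma pair_inv_closed : inv_closed (f * recip f).
Proof.
move=> a /ev_mul_eq0[/root_recip|/recip_root] [a0 fa]; split=> //; apply/ev_mul_eq0;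
  by [right | left].
Qed.

Lemma pair_unramified : unramified (f * recip f).
Proof.
move=> a aP; apply/eqP => aV; apply: fr.
suff [fa ra] : ev a f = 0 /\ ev a (recip f) = 0 by apply: irr_monic_eq fa ra.
by case/ev_mul_eq0: aP => [/[dup] fa /root_recip|/[dup] ra /recip_root] [_];
  rewrite -aV.
Qed.

Lemma pair_monic : f * recip f \is monic.
Proof. by rewrite monicMl. Qed.

Lemma pair_size : size (f * recip f) = d.*2.+1.
Proof. by rewrite size_mul ?monic_neq0 // size_recip // sf; lia. Qed.

Lemma pair_units : local_count unit_at (f * recip f) = ((#|F| ^ d).-1 ^ 2)%N.
Proof.
rewrite local_count_mul ?pair_separable //; try exact: residual_unit.
by rewrite !card_units_irreducible // size_recip // sf mulnn.
Qed.

(** Vanishing of a fixed residue at one root spreads to conjugates by irreducibility and to inverses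
    by invariance, hence to all roots of both factors. *)
Lemma pair_fixed_units : local_count fixed_unit_at (f * recip f) = (#|F| ^ d).-1.
Proof.
rewrite card_fixed_units ?pair_separable //; last 2 first.
- by rewrite pair_size; have := fst fi; rewrite sf; lia.
- move=> p a b pF ga gb pa.
  have vanish h c : irreducible_poly h -> ev c h = 0 -> ev c p = 0 ->
      forall e, ev e h = 0 -> ev e p = 0.
    by move=> hi hc pc e he; apply: ev_dvd he; apply: irr_dvd hc pc.
  have pa' : ev a^-1 p = 0 by rewrite pF.
  case/ev_mul_eq0: (ga) => /[dup] fa => [/root_recip|/recip_root] [_ fa'];
    case/ev_mul_eq0: gb => fb.
  + exact: vanish fa pa _ fb.
  + exact: vanish fa' pa' _ fb.
  + exact: vanish fa' pa' _ fb.
  + exact: vanish fa pa _ fb.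
congr _.-1; have := card_fixed_sqr pair_separable pair_inv_closed pair_unramified.
by rewrite pair_size /= -muln2 expnM => /eqP; rewrite eqn_exp2r // => /eqP.
Qed.

(** Inversion swaps the two factors, so the norm condition merely prescribes the root modulo
    [recip f] as the inverse of p(1/x). What remains is an M-th root of x modulo [f]. *)
Lemma pair_norm1_root M : (0 < M)%N ->
  norm1_root M (f * recip f) <->
  exists h, [/\ h \is monic, irreducible_poly h, size h = d.+1 & h %| compXM M f].
Proof.
move=> M_gt0; split=> [[p pP]|[h [hm hi sh hf]]].
  have [a fa] := ev_root_exists iota (fst fi).
  have [|paM _] := pP a; first by apply/ev_mul_eq0; left.
  have [h [hm hi hb sh hg]] := power_factor fi fa paM.
  by exists h; split; rewrite ?sh.
have [b hb] := ev_root_exists iota (fst hi).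
have [|fb [p pb]] := power_root fi hi _ hf hb; first by rewrite sf sh.
have pM c : ev c f = 0 -> ev c p ^+ M = c.
  by apply: (ev_power_irr fi fb); rewrite pb.
have rne c : ev c (recip f) = 0 -> c != 0 by case/recip_root.
have [y yP] := ev_invX rne.
have [|q qP] := @ev_inv _ _ iota (p \Po y) (recip f).
  apply/(coprimep_evP iota) => c rc; rewrite ev_comp yP //.
  have [c0 fc] := (recip_root c).1 rc; have := pM _ fc; apply: contra_eq_neq => ->.
  by rewrite expr0n gtn_eqF // eq_sym invr_eq0.
have {}qP c : ev c (recip f) = 0 -> ev c q = (ev c^-1 p)^-1.
  by move=> rc; rewrite qP // ev_comp yP.
have [r [r1 r2]] := crt iota p q pair_coprime.
have p0 c : ev c f = 0 -> ev c p != 0.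
  move=> fc; have [c0 _] := root_recip fc.
  by apply: contraNneq c0 => pc; rewrite -(pM c fc) pc expr0n gtn_eqF.
exists r => c /ev_mul_eq0[fc|rc].
  have [c0 rc] := root_recip fc; rewrite (r1 c) // r2 // qP // invrK.
  by split; [exact: pM | rewrite mulVf // p0].
have [c0 fc] := (recip_root c).1 rc; rewrite (r2 c) // r1 // qP //.
by rewrite exprVn pM // invrK; split=> //; rewrite mulfV // p0.
Qed.

End ReciprocalPair.
End Atoms.

Lemma separable1 (R : idomainType) : separable_poly (1 : {poly R}).
Proof. by have := separable_prod_XsubC (Nil R); rewrite big_nil. Qed.

(** * Powers of isometries *)

Section MatrixPowers.
Variables (F : finFieldType) (L : closedFieldType) (iota : {rmorphism F -> L}).
Hypothesis algL : integralRange iota.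
Local Notation ev := (ev iota).
Variables (n : nat) (J X : 'M[F]_n.+1).
Hypotheses (Ju : J \in unitmx) (XJ : preserves X J).
Hypothesis fsep : separable_poly (char_poly X).

(** [Y] commutes with X = Y^M, so Y = p(X). Its adjoint is p(1/X), hence [Y] is an isometry exactly
    when p(1/x) p(x) = 1 at the roots. *)
Lemma isometry_power_norm1 M :
  (exists2 Y : 'M[F]_n.+1, preserves Y J & Y ^+ M = X) <->
  norm1_root iota M (char_poly X).
Proof.
have fV := preserves_inv_closed (iota := iota) Ju XJ.
have f0 a : ev a (char_poly X) = 0 -> a != 0 by case/fV.
have [y yP] := ev_invX f0.
have pJ p : (horner_mx X p)^T *m J *m horner_mx X p = J *m horner_mx X ((p \Po y) * p).
  by rewrite (horner_adjoint fsep yP f0) // -mulmxA mulmxE -rmorphM.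
have pE p a : ev a (char_poly X) = 0 -> ev a ((p \Po y) * p) = ev a^-1 p * ev a p.
  by move=> fa; rewrite rmorphM /= ev_comp yP.
split=> [[Y YJ YM]|[p pP]].
  have [|p _ Yp] := @centralizer_horner _ _ _ algL _ X Y fsep.
    by rewrite mulmxE -YM -exprSr -exprS.
  exists p => a fa; split.
    rewrite -rmorphXn /= -[RHS](evX iota a).
    by apply: (horner_mx_eq iota _ _ fsep).1 fa; rewrite rmorphXn /= horner_mx_X -Yp.
  rewrite -pE // -(rmorph1 (ev a)); apply: (horner_mx_eq iota _ _ fsep).1 fa.
  apply: (can_inj (mulKmx Ju)); rewrite -pJ -Yp rmorph1 mulmx1; exact: YJ.
exists (horner_mx X p).
  rewrite /preserves pJ -[RHS]mulmx1 -[1%:M]/(1 : 'M_n.+1) -(rmorph1 (horner_mx X)).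
  congr (_ *m _); apply/(horner_mx_eq iota) => // a fa.
  by rewrite pE // rmorph1; case: (pP _ fa).
rewrite -rmorphXn -[RHS]horner_mx_X; apply/(horner_mx_eq iota) => // a fa.
by rewrite rmorphXn /= evX; case: (pP _ fa).
Qed.

End MatrixPowers.

(** * Factorization into atoms and weights *)

Section AtomTheory.
Variables (F : finFieldType) (L : closedFieldType) (iota : {rmorphism F -> L}).
Hypothesis algL : integralRange iota.
Local Notation ev := (ev iota).
Local Notation inv_closed := (inv_closed iota).
Local Notation unramified := (unramified iota).
Local Notation local_count := (local_count iota).
Local Notation unit_at := (unit_at iota).
Local Notation fixed_unit_at := (fixed_unit_at iota).
Implicit Types (f g h p q : {poly F}) (a b : L).

Definition atom d g := (0 < d)%N /\
  ((SRIM g /\ size g = d.*2.+1) \/ exists2 f, nonself d f & g = f * recip f).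

Lemma atom_monic d g : atom d g -> g \is monic.
Proof. by case=> _ [[[]]|[f fN ->]] //; apply: (pair_monic iota fN). Qed.

Lemma atom_size d g : atom d g -> size g = d.*2.+1.
Proof. by case=> _ [[]|[f fN ->]] //; apply: (pair_size iota fN). Qed.

Lemma atom_separable d g : atom d g -> separable_poly g.
Proof.
case=> d0 [[gS sg]|[f fN ->]]; first exact: (srim_separable iota gS).
exact: (pair_separable algL fN).
Qed.

Lemma atom_inv_closed d g : atom d g -> inv_closed g.
Proof.
case=> d0 [[gS sg]|[f fN ->]]; first exact: (srim_inv_closed d0 gS sg).
exact: (pair_inv_closed algL fN).
Qed.

Lemma atom_unramified d g : atom d g -> unramified g.
Proof.
case=> d0 [[gS sg]|[f fN ->]]; first exact: (srim_unramified d0 gS sg).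
exact: (pair_unramified algL fN).
Qed.

(** An atom is determined by the minimal polynomial of any one of its roots. *)
Lemma atom_of_root d g f a : atom d g -> ev a g = 0 ->
  f \is monic -> irreducible_poly f -> ev a f = 0 ->
  g = if recip f == f then f else f * recip f.
Proof.
move=> [d0 gA] ga fm fi fa; case: gA => [[[gm gi gr] sg]|[h hN Eg]].
  by rewrite -(irr_monic_eq gi fi gm fm ga fa) -gr eqxx.
have [hm hi hX _ hr] := hN; have [rm ri rX _ rr] := nonself_recip algL hN.
move: ga; rewrite Eg => /ev_mul_eq0[] ha.
  by rewrite -(irr_monic_eq hi fi hm fm ha fa) eq_sym (introF eqP hr).
rewrite -(irr_monic_eq ri fi rm fm ha fa) (recip_involutive algL hm hi hX).
by rewrite (introF eqP hr) mulrC.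
Qed.

Lemma atom_inj d d' g g' a : atom d g -> atom d' g' -> ev a g = 0 -> ev a g' = 0 ->
  g = g'.
Proof.
move=> gA gA' ga ga'; have [f [fm fi fa]] := minpoly_exists algL a.
by rewrite (atom_of_root gA ga fm fi fa) (atom_of_root gA' ga' fm fi fa).
Qed.

Lemma atom_exists f a : separable_poly f -> inv_closed f -> unramified f ->
  ev a f = 0 -> exists d g, [/\ atom d g, ev a g = 0 & g %| f].
Proof.
move=> fsep fV fU fa; have [g [gm gi ga]] := minpoly_exists algL a.
have gf := irr_dvd gi ga fa; have [a0 fa'] := fV _ fa.
have gX : g <> 'X by move=> gX; move: ga a0; rewrite gX evX => ->; rewrite eqxx.
have g0 := irr_coef0 iota gm gi gX.
have gr b : ev b g = 0 -> ev b^-1 (recip g) = 0.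
  move=> gb; have b0 := ev_neq0 gi gb gm (introN eqP gX).
  by apply/ev_recip; rewrite ?invr_eq0 ?invrK.
have [rg|/eqP rg] := eqVneq (recip g) g; last first.
  have gN : nonself (size g).-1 g.
    split=> //; last by move/esym.
    by rewrite prednK // ltnW // (fst gi).
  exists (size g).-1, (g * recip g); split.
  - split; last by right; exists g.
    by have := fst gi; case: (size g) => [|[]].
  - by apply/ev_mul_eq0; left.
  rewrite Gauss_dvdp ?(pair_coprime algL gN) // gf /=.
  exact: irr_dvd (recip_irr algL gm gi gX) (gr _ ga) fa'.
(* A self-reciprocal [g] has even degree: inversion permutes its distinct roots without fixed
   points. *)
have [rs Ers] := closed_field_poly_normal (map_poly iota g).
have lg : lead_coef (map_poly iota g) = 1.
  by rewrite lead_coef_map (monicP gm) rmorph1.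
rewrite lg scale1r in Ers.
have rsP b : (b \in rs) = (ev b g == 0).
  by rewrite -root_prod_XsubC -Ers.
have rs_uniq : uniq rs.
  by rewrite -separable_prod_XsubC -Ers separable_map (irr_separable iota).
have ev_size : ~~ odd (size rs).
  apply: (even_size_involution (h := fun b => b^-1)) => // b.
  rewrite rsP => /eqP gb; split; last exact: invrK.
    by rewrite rsP -rg gr.
  by rewrite eq_sym; apply: fU; apply: ev_dvd gf gb.
have sg : size g = (size rs).+1.
  by rewrite -(size_map_poly iota) Ers size_prod_XsubC.
exists (size rs)./2, g; split=> //; split; last first.
  by left; split; [split | rewrite sg even_halfK].
have : (1 < size g)%N := fst gi; move: ev_size; rewrite sg.
by case: (size rs) => [|[|]].
Qed.

(** The U(f) / V(f) of the overview. *)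
Definition weight f : rat :=
  (local_count fixed_unit_at f)%:R / (local_count unit_at f)%:R.

Lemma weight1 : weight 1 = 1.
Proof.
suff E Q : local_count Q 1 = 1%N by rewrite /weight !E divr1.
rewrite (@local_countE _ _ _ 0) ?size_poly1 //.
transitivity #|{: 'rV[F]_0}|; last by rewrite card_mx muln0 expn0.
apply: eq_card => v; rewrite !inE; apply/asboolP => a.
by rewrite rmorph1 => /eqP; rewrite oner_eq0.
Qed.

Lemma weight_mul g h : separable_poly (g * h) -> inv_closed g -> inv_closed h ->
  weight (g * h) = weight g * weight h.
Proof.
move=> ghsep gV hV; rewrite /weight.
rewrite (local_count_mul ghsep (residual_fixed_unit gV) (residual_fixed_unit hV)).
rewrite (local_count_mul ghsep (@residual_unit _ _ _ g) (@residual_unit _ _ _ h)).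
by rewrite !natrM invfM mulrACA.
Qed.

Lemma units_neq0 f : separable_poly f -> (local_count unit_at f)%:R != 0 :> rat.
Proof.
move=> fsep; rewrite pnatr_eq0 -lt0n; apply/card_gt0P.
exists (poly_rV (1 %% f)); rewrite inE; apply/asboolP => a fa.
rewrite poly_rV_K ?size_modp_pred ?separable_poly_neq0 //.
by rewrite /unit_at ev_mod // rmorph1 oner_eq0.
Qed.

Let q1 d : (0 < d)%N -> (0 < (#|F| ^ d).-1)%N.
Proof.
move=> d0; have := finNzRing_gt1 F; rewrite -(ltn_exp2r _ _ d0) exp1n.
by case: (_ ^ _)%N => [|[]].
Qed.

Lemma weight_srim d g : (0 < d)%N -> SRIM g -> size g = d.*2.+1 ->
  weight g = (#|F|%:R ^+ d + 1)^-1.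
Proof.
move=> d0 gS sg; rewrite /weight (srim_fixed_units iota d0 gS sg) (srim_units iota gS sg).
rewrite -natrX natr1; have := q1 d0; rewrite -addnn expnD.
move: (#|F| ^ d)%N => [|Q] // Q0; rewrite succnK in Q0 *.
(* With q^d = Q + 1, the denominator q^(2d) - 1 is Q (Q + 2), and the numerator [Q] cancels. *)
have -> : (Q.+1 * Q.+1).-1 = (Q * Q.+2)%N by lia.
by rewrite natrM invfM mulrA mulfV ?mul1r // pnatr_eq0 -lt0n.
Qed.

Lemma weight_pair d f : (0 < d)%N -> nonself d f ->
  weight (f * recip f) = (#|F|%:R ^+ d - 1)^-1.
Proof.
move=> d0 fN; rewrite /weight (pair_fixed_units algL fN) (pair_units algL fN).
have := q1 d0; have -> : (#|F|%:R ^+ d - 1 : rat) = ((#|F| ^ d).-1)%:R.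
  by rewrite -natrX -subn1 natrB // expn_gt0 (ltnW (finNzRing_gt1 F)).
move: (_.-1) => Q Q0; have Q1 : Q%:R != 0 :> rat by rewrite pnatr_eq0 -lt0n.
by rewrite natrX expr2 invfM mulrA mulfV ?mul1r.
Qed.

Lemma ev_prod (s : seq {poly F}) a :
  ev a (\prod_(g <- s) g) = 0 <-> exists2 g, g \in s & ev a g = 0.
Proof.
elim: s => [|g s IHs].
  by rewrite big_nil rmorph1; split=> [/eqP|[g]]; rewrite ?oner_eq0 ?in_nil.
rewrite big_cons; split=> [/ev_mul_eq0[ga|/IHs[h hs ha]]|[h]].
- by exists g; rewrite ?mem_head.
- by exists h; rewrite // inE hs orbT.
by rewrite inE => /orP[/eqP->|hs] ha; apply/ev_mul_eq0; [left | right; apply/IHs; exists h].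
Qed.

Section Products.
Variable s : seq {poly F}.
Hypotheses (s_uniq : uniq s) (s_atom : forall g, g \in s -> exists d, atom d g).

(** Distinct atoms share no root, so each new factor is coprime to the product of the others. *)
Lemma prod_atoms_ind (P : seq {poly F} -> Prop) : P [::] ->
  (forall g t d, g \in s -> atom d g -> separable_poly (g * \prod_(h <- t) h) ->
     inv_closed (\prod_(h <- t) h) -> P t -> P (g :: t)) ->
  P s.
Proof.
move=> P0 PM.
(* Induction over subsequences of [s] keeps its uniqueness and [s_atom] available. *)
suff: forall t, subseq t s -> [/\ separable_poly (\prod_(g <- t) g),
    inv_closed (\prod_(g <- t) g) & P t].
  by move=> /(_ s (subseq_refl s))[].
elim=> [_|g t IHt gts].
  rewrite big_nil; split=> //; first exact: separable1.
  by move=> a /eqP; rewrite rmorph1 oner_eq0.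
have [sep_t inv_t Pt] := IHt (subseq_trans (subseq_cons _ _) gts).
have gs : g \in s by apply: (mem_subseq gts); rewrite mem_head.
have [d gA] := s_atom gs.
have cgt : coprimep g (\prod_(h <- t) h).
  apply/(coprimep_evP iota) => a /ev_prod[h ht ha]; apply/eqP => ga.
  have hs : h \in s by apply: (mem_subseq gts); rewrite inE ht orbT.
  have [d' hA] := s_atom hs.
  have := subseq_uniq gts s_uniq; rewrite /= => /andP[/negP gt _]; apply: gt.
  by rewrite (atom_inj gA hA ga ha).
have sep_gt : separable_poly (g * \prod_(h <- t) h).
  by rewrite separable_mul (atom_separable gA) sep_t cgt.
rewrite big_cons; split=> //; first exact: inv_closed_mul (atom_inv_closed gA) inv_t.
exact: PM gA sep_gt inv_t Pt.
Qed.

Lemma prod_atoms_separable : separable_poly (\prod_(g <- s) g).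
Proof.
apply: (prod_atoms_ind (P := fun t => separable_poly (\prod_(g <- t) g))) => [|*].
  by rewrite big_nil separable1.
by rewrite big_cons.
Qed.

Lemma prod_atoms_inv_closed : inv_closed (\prod_(g <- s) g).
Proof.
apply: (prod_atoms_ind (P := fun t => inv_closed (\prod_(g <- t) g)))
  => [a|g t d gs gA _ tV _].
  by rewrite big_nil rmorph1 => /eqP; rewrite oner_eq0.
by rewrite big_cons; exact: inv_closed_mul (atom_inv_closed gA) tV.
Qed.

Lemma prod_atoms_unramified : unramified (\prod_(g <- s) g).
Proof. by move=> a /ev_prod[g /s_atom[d gA]]; apply: (atom_unramified gA). Qed.

Lemma prod_atoms_monic : \prod_(g <- s) g \is monic.
Proof.
by rewrite big_seq; apply: monic_prod => g /s_atom[d /atom_monic].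
Qed.

Lemma prod_atoms_norm1 M : (forall g, g \in s -> norm1_root iota M g) ->
  norm1_root iota M (\prod_(g <- s) g).
Proof.
move=> sM.
apply: (prod_atoms_ind (P := fun t => norm1_root iota M (\prod_(g <- t) g)))
  => [|g t d gs gA].
  by rewrite big_nil; exists 0 => a; rewrite rmorph1 => /eqP; rewrite oner_eq0.
rewrite separable_mul big_cons => /and3P[_ _ cgt] tV tM.
exact: norm1_root_mul cgt (atom_inv_closed gA) tV (sM _ gs) tM.
Qed.

Lemma weight_prod_atoms : weight (\prod_(g <- s) g) = \prod_(g <- s) weight g.
Proof.
apply: (prod_atoms_ind
  (P := fun t => weight (\prod_(g <- t) g) = \prod_(g <- t) weight g))
  => [|g t d gs gA sep tV IHt].
  by rewrite !big_nil weight1.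
by rewrite !big_cons -IHt weight_mul //; exact: atom_inv_closed gA.
Qed.

Lemma size_prod_atoms :
  size (\prod_(g <- s) g) = (\sum_(g <- s) (size g).-1./2).*2.+1.
Proof.
have : forall g, g \in s -> exists d, atom d g := s_atom.
clear s_uniq s_atom; elim: s => [|g t IHt] tA; first by rewrite !big_nil size_poly1.
have [d gA] := tA g (mem_head _ _).
have {}IHt := IHt (fun h ht => tA h (mem_behead (s := g :: t) ht)).
have g0 := monic_neq0 (atom_monic gA).
have t0 : \prod_(h <- t) h != 0 by rewrite -size_poly_eq0 IHt.
by rewrite !big_cons size_mul // IHt (atom_size gA) /= doubleK; lia.
Qed.

End Products.
End AtomTheory.

(** * Symplectic groups *)

Section SymplecticGroup.
Variables (F : finFieldType) (L : closedFieldType) (iota : {rmorphism F -> L}).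
Hypothesis algL : integralRange iota.
Local Notation ev := (ev iota).
Local Notation inv_closed := (inv_closed iota).
Local Notation unramified := (unramified iota).
Implicit Types (f g h p q : {poly F}) (a b : L).

Lemma char_poly_exists f n : f \is monic -> size f = n.+1 ->
  exists C : 'M[F]_n, char_poly C = f.
Proof.
move=> fm sf; have : char_poly (companionmx f) = f := companionmxK fm.
by move: (companionmx f); rewrite sf /= => C; exists C.
Qed.

Lemma Sp_card_gt0 m : (0 < #|Sp F m|)%N.
Proof. by apply/card_gt0P; exists 1%:M; rewrite inE trmx1 mul1mx mulmx1. Qed.

Lemma Sp_inv_closed m (X : 'M[F]_(m.+1 + m.+1)) : X \in Sp F m.+1 -> inv_closed (char_poly X).
Proof.
rewrite inE => /eqP.
exact: (@preserves_inv_closed _ _ iota (m + m.+1) X _ (sympJ_unit F m.+1)).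
Qed.

Lemma Sp_unramified m (X : 'M[F]_(m.+1 + m.+1)) : X \in Sp F m.+1 ->
  separable_poly (char_poly X) -> unramified (char_poly X).
Proof.
rewrite inE => /eqP XJ fsep.
exact: (@preserves_unramified _ _ iota algL (m + m.+1) X _ fsep (sympJ_unit F m.+1)
  (sympJ_alternating F m.+1) XJ).
Qed.

Lemma Sp_Mth_power m M (X : 'M[F]_(m.+1 + m.+1)) : X \in Sp F m.+1 ->
  separable_poly (char_poly X) ->
  is_Mth_power_Sp M X <-> norm1_root iota M (char_poly X).
Proof.
rewrite inE => /eqP XJ fsep.
rewrite -(@isometry_power_norm1 _ _ iota algL (m + m.+1) _ X (sympJ_unit F m.+1) XJ fsep).
split=> [/existsP[Y /andP[]]|[Y YJ YM]].
  by rewrite inE => /eqP YJ /eqP YM; exists Y.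
by apply/existsP; exists Y; rewrite inE; apply/andP; split; apply/eqP.
Qed.

(** The count of isometries applies to a companion matrix of [f], since every nondegenerate
    alternating form is congruent to [sympJ]. *)
Lemma card_Sp_char_poly m f : f \is monic -> size f = m.+1.*2.+1 ->
  separable_poly f -> inv_closed f -> unramified f ->
  #|[set X in Sp F m.+1 | char_poly X == f]|%:R = weight iota f * #|Sp F m.+1|%:R.
Proof.
move=> fm sf fsep fV fU; rewrite -addnn in sf.
have [C EC] := @char_poly_exists f (m.+1 + m.+1) fm sf.
rewrite -EC in fsep fV fU *.
have := @card_isometries_char_poly _ _ iota algL (m + m.+1) C fsep _
  (sympJ_unit F m.+1) (sympJ_alternating F m.+1) (@symplectic_basis F m.+1) fV fU.
move=> H; rewrite /weight; apply: (mulIf (units_neq0 iota fsep)).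
rewrite mulrAC divfK ?units_neq0 // -!natrM -H; congr ((_ * _)%:R).
by apply: eq_card => X; rewrite !inE.
Qed.

(** Rows of [k] coefficients make this a finite set; k = 2n + 1 accommodates every atom of degree at
    most 2n. *)
Definition good_atoms k M : {set 'rV[F]_k} :=
  [set v | `[< exists2 d, atom d (rVpoly v) & norm1_root iota M (rVpoly v) >] ].

Definition half_degree k (v : 'rV[F]_k) := (size (rVpoly v)).-1./2.

Definition atom_product k (S : {set 'rV[F]_k}) := \prod_(v in S) rVpoly v.

Section Subsets.
Variables (k M : nat) (S : {set 'rV[F]_k}).
Hypothesis SA : S \subset good_atoms k M.

Lemma atom_productE :
  atom_product S = \prod_(g <- [seq rVpoly v | v <- enum S]) g.
Proof. by rewrite big_map big_enum. Qed.

Lemma atom_seq_uniq : uniq [seq rVpoly v | v <- enum S].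
Proof. by rewrite map_inj_uniq ?enum_uniq //; exact: can_inj rVpolyK. Qed.

Lemma atom_seqP g : g \in [seq rVpoly v | v <- enum S] ->
  (exists d, atom d g) /\ norm1_root iota M g.
Proof.
case/mapP=> v; rewrite mem_enum => /(subsetP SA); rewrite inE => /asboolP[d vA vM] ->.
by split=> //; exists d.
Qed.

Let seq_atom g gS := (@atom_seqP g gS).1.

Lemma atom_product_size : size (atom_product S) = (\sum_(v in S) half_degree v).*2.+1.
Proof. by rewrite atom_productE (size_prod_atoms iota seq_atom) ?big_map ?big_enum. Qed.

Lemma atom_product_monic : atom_product S \is monic.
Proof. by rewrite atom_productE (prod_atoms_monic iota seq_atom). Qed.

Lemma atom_product_separable : separable_poly (atom_product S).
Proof. by rewrite atom_productE (prod_atoms_separable algL atom_seq_uniq seq_atom). Qed.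

Lemma atom_product_inv_closed : inv_closed (atom_product S).
Proof. by rewrite atom_productE; apply: (prod_atoms_inv_closed algL atom_seq_uniq seq_atom). Qed.

Lemma atom_product_unramified : unramified (atom_product S).
Proof. by rewrite atom_productE; apply: (prod_atoms_unramified algL seq_atom). Qed.

Lemma atom_product_norm1 : norm1_root iota M (atom_product S).
Proof.
rewrite atom_productE; apply: (prod_atoms_norm1 algL atom_seq_uniq seq_atom) => g.
by case/atom_seqP.
Qed.

Lemma atom_product_weight :
  weight iota (atom_product S) = \prod_(v in S) weight iota (rVpoly v).
Proof.
by rewrite atom_productE (weight_prod_atoms algL atom_seq_uniq seq_atom) big_map big_enum.
Qed.

Lemma atom_product_root a :
  ev a (atom_product S) = 0 <-> exists2 v, v \in S & ev a (rVpoly v) = 0.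
Proof.
rewrite atom_productE ev_prod; split=> [[g /mapP[v]]|[v vS va]].
  by rewrite mem_enum => vS -> va; exists v.
by exists (rVpoly v) => //; apply: map_f; rewrite mem_enum.
Qed.

(** Atoms with a common root are equal, so the product determines the set [S]. *)
Lemma mem_atom_product v : (v \in S) = (v \in good_atoms k M) && (rVpoly v %| atom_product S).
Proof.
apply/idP/andP => [vS|[]].
  by rewrite (subsetP SA) // /atom_product (bigD1 v) //= dvdp_mulr.
rewrite inE => /asboolP[d vA _] vP.
have [|a va] := @ev_root_exists _ _ iota (rVpoly v).
  by rewrite (atom_size iota vA); case: vA; lia.
have /atom_product_root[u uS ua] := ev_dvd vP va.
have := subsetP SA _ uS; rewrite inE => /asboolP[d' uA _].
by rewrite (can_inj rVpolyK (atom_inj algL vA uA va ua)).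
Qed.

End Subsets.

(** Both polynomials are monic and separable, so comparing roots suffices. The bound on [m] lets
    every atom of [f] fit into 2n + 1 coefficients. *)
Lemma atom_factorization n m M f : (m <= n)%N -> f \is monic -> size f = m.*2.+1 ->
  separable_poly f -> inv_closed f -> unramified f -> norm1_root iota M f ->
  let S := [set v in good_atoms n.*2.+1 M | rVpoly v %| f] in
  [/\ S \subset good_atoms n.*2.+1 M, \sum_(v in S) half_degree v = m & atom_product S = f].
Proof.
move=> mn fm sf fsep fV fU fM S.
have SA : S \subset good_atoms n.*2.+1 M by apply/subsetP => v; rewrite inE => /andP[].
have ES : atom_product S = f.
  apply/eqP; rewrite -eqp_monic ?(atom_product_monic SA) //; apply/andP; split.
    apply: (sep_dvd (iota := iota) (atom_product_separable SA)) => a /atom_product_root[v].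
    by rewrite inE => /andP[_ vf] va; apply: ev_dvd vf va.
  apply: (sep_dvd (iota := iota) fsep) => a fa; apply/atom_product_root.
  have [d [g [gA ga gf]]] := atom_exists algL fsep fV fU fa.
  have sg : (size g <= n.*2.+1)%N.
    apply: leq_trans (dvdp_leq (monic_neq0 fm) gf) _.
    by rewrite sf ltnS leq_double.
  exists (poly_rV g); last by rewrite poly_rV_K.
  rewrite !inE poly_rV_K // gf andbT; apply/asboolP.
  by exists d => //; apply: norm1_root_dvd gf fM.
split=> //; apply/eqP; rewrite -(eqn_pmul2r (ltn0Sn 1)) !muln2 -eqSS.
by rewrite -sf -ES (atom_product_size SA).
Qed.

(* Every separable M-th power has its characteristic polynomial equal to the
   product of exactly one set of good atoms. *)
Lemma card_separable_Mth_powers n m M : (m.+1 <= n)%N ->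
  #|[set X in Sp F m.+1 | separable_mx X && is_Mth_power_Sp M X]|%:R =
  (\sum_(S : {set 'rV[F]_(n.*2.+1)} | (S \subset good_atoms n.*2.+1 M) &&
      (\sum_(v in S) half_degree v == m.+1))
     \prod_(v in S) weight iota (rVpoly v)) * #|Sp F m.+1|%:R :> rat.
Proof.
move=> mn; pose ok (S : {set 'rV[F]_(n.*2.+1)}) :=
  (S \subset good_atoms n.*2.+1 M) && (\sum_(v in S) half_degree v == m.+1)%N.
rewrite mulr_suml.
transitivity (\sum_(S | ok S) #|[set X in Sp F m.+1 | char_poly X == atom_product S]|%:R : rat);
  last first.
  apply: eq_bigr => S /andP[SA /eqP Sm].
  rewrite (card_Sp_char_poly (atom_product_monic SA)) ?(atom_product_weight SA) //.
  - by rewrite (atom_product_size SA) Sm.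
  - exact: atom_product_separable SA.
  - exact: atom_product_inv_closed SA.
  - exact: atom_product_unramified SA.
rewrite -natr_sum; congr _%:R.
under [RHS]eq_bigr => S _ do rewrite -sum1_card.
(* The pairs (X, S) are counted by [X]: a separable M-th power has exactly one admissible [S], any
   other matrix none. *)
rewrite (exchange_big_dep (mem (Sp F m.+1))) /=; last by move=> S X _; rewrite inE => /andP[].
rewrite -sum1_card big_mkcond [RHS]big_mkcond /=; apply: eq_bigr => X _.
rewrite inE; case XSp: (X \in Sp F m.+1) => //=.
case: ifP => [/andP[Xsep XM]|XN]; last first.
  rewrite big1 // => S /andP[]; rewrite inE XSp /= => /andP[SA Sm] /eqP EX.
  case/negP: XN; apply/andP; split.
    by rewrite /separable_mx EX (atom_product_separable SA).
  by apply/(Sp_Mth_power M XSp); rewrite EX ?(atom_product_separable SA) //;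
    apply: atom_product_norm1.
have fV := Sp_inv_closed XSp; have fU := Sp_unramified XSp Xsep.
have XN := (Sp_Mth_power M XSp Xsep).1 XM.
have [|SA Sm SP] := atom_factorization mn (char_poly_monic X) _ Xsep fV fU XN.
  by rewrite size_char_poly addnn.
rewrite (big_pred1 [set v in good_atoms n.*2.+1 M | rVpoly v %| char_poly X]) // => S /=.
rewrite inE XSp /=; apply/andP/eqP => [[/andP[SA' _] /eqP EX]|->].
  by apply/setP => v; rewrite (mem_atom_product SA') inE EX.
by rewrite /ok SA Sm SP !eqxx.
Qed.

Lemma coef_prod_good_atoms k M (w : 'rV[F]_k -> rat) m (A := good_atoms k M) :
  (\prod_(v in A) (1 + w v *: 'X^(half_degree v)))`_m =
  \sum_(S : {set 'rV[F]_k} | (S \subset A) && (\sum_(v in S) half_degree v == m))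
     \prod_(v in S) w v.
Proof.
rewrite big_mkcond /=.
(* Factors outside [A] become 0 + 1, so the expansion can range over all sets; a set not contained
   in [A] contributes 0. *)
rewrite (eq_bigr (fun v => (if v \in A then w v *: 'X^(half_degree v) else 0) + 1)); last first.
  by move=> v _; case: ifP; rewrite ?add0r // addrC.
rewrite bigA_distr coef_sum [RHS]big_mkcondr [RHS]big_mkcond /=; apply: eq_bigr => S _.
rewrite -big_mkcond /=; case: ifPn => [SA|/subsetPn[v vS vA]]; last first.
  by rewrite (bigD1 v) //= (negPf vA) mul0r coef0.
rewrite (eq_bigr (fun v => w v *: 'X^(half_degree v))) => [|v vS]; last first.
  by rewrite (subsetP SA).
rewrite scaler_prod -expr_sum coefZ coefXn eq_sym.
by case: eqP => _; rewrite ?mulr1 ?mulr0.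
Qed.

End SymplecticGroup.

(** * Comparison with the counts of power polynomials *)

Section Coefficients.
Variables (F : finFieldType) (n : nat).

Lemma coef_polyT (t : {ffun 'I_n -> F}) (i : 'I_n) : (polyT t)`_i = t i.
Proof. by rewrite coef_poly ltn_ord valK. Qed.

Lemma size_polyT (t : {ffun 'I_n -> F}) : (size (polyT t) <= n)%N.
Proof. exact: size_poly. Qed.

Lemma coefTK : cancel (@polyT F n) (@coefT F n).
Proof. by move=> t; apply/ffunP => i; rewrite ffunE coef_polyT. Qed.

Lemma polyTK (p : {poly F}) : (size p <= n)%N -> polyT (coefT n p) = p.
Proof.
move=> sp; apply/polyP => i; have [ni|ni] := ltnP i n.
  by rewrite -[i]/(nat_of_ord (Ordinal ni)) coef_polyT ffunE.
by rewrite !nth_default // (leq_trans _ ni) // size_polyT.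
Qed.

End Coefficients.

(** Both images are in bijection with the image of the paired map. This serves to replace unordered
    pairs by products. *)
Lemma card_imset_kernel (aT rT rT' : finType) (h : aT -> rT) (h' : aT -> rT')
    (T : {set aT}) :
  {in T &, forall x y, h x = h y <-> h' x = h' y} -> #|h @: T| = #|h' @: T|.
Proof.
move=> hh'; pose u x := (h x, h' x).
transitivity #|u @: T|.
  rewrite -(_ : fst @: (u @: T) = h @: T); last by rewrite -imset_comp.
  apply: card_in_imset => _ _ /imsetP[x xT ->] /imsetP[y yT ->] /= hxy.
  by rewrite /u hxy ((hh' x y xT yT).1 hxy).
rewrite -(_ : snd @: (u @: T) = h' @: T); last by rewrite -imset_comp.
apply/esym/card_in_imset => _ _ /imsetP[x xT ->] /imsetP[y yT ->] /= hxy.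
by rewrite /u hxy ((hh' x y xT yT).2 hxy).
Qed.

Section Counting.
Variables (F : finFieldType) (L : closedFieldType) (iota : {rmorphism F -> L}).
Hypothesis algL : integralRange iota.
Local Notation ev := (ev iota).
Local Notation good_atoms := (good_atoms iota).
Implicit Types (f g h p q : {poly F}) (a b : L).

Lemma half_degree_atom k (v : 'rV[F]_k) d : atom d (rVpoly v) -> half_degree v = d.
Proof. by move=> vA; rewrite /half_degree (atom_size iota vA) /= doubleK. Qed.

Lemma pair_reducible d f : (0 < d)%N -> nonself d f -> ~ irreducible_poly (f * recip f).
Proof.
move=> d0 fN gi; have [_ _ _ sf _] := fN.
have := apply_irredp gi _ (dvdp_mulr (recip f) (dvdpp f)).
rewrite sf => /(_ _) /eqp_size; rewrite sf (pair_size iota fN) => H.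
by have := H (introN eqP _); case: (d) d0 H => // d' _; lia.
Qed.

Lemma card_good_srim n d M : (0 < d <= n)%N ->
  #|[set v in good_atoms n.*2.+1 M |
      (half_degree v == d) && `[< irreducible_poly (rVpoly v) >]]|
  = NstarM F M d.
Proof.
case/andP=> d0 dn; have dn2 : (d.*2.+1 <= n.*2.+1)%N by rewrite ltnS leq_double.
have tK (t : {ffun 'I_(d.*2.+1) -> F}) :
    rVpoly (poly_rV (polyT t) : 'rV_(n.*2.+1)) = polyT t.
  by rewrite poly_rV_K // (leq_trans (size_polyT t)).
have inj : injective (fun t : {ffun 'I_(d.*2.+1) -> F} => poly_rV (polyT t) : 'rV_(n.*2.+1)).
  by move=> t u /(congr1 rVpoly); rewrite !tK => /(can_inj (@coefTK _ _)).
rewrite /NstarM -(card_imset _ inj); congr #|pred_of_set _|; apply/setP => v.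
rewrite inE; apply/andP/imsetP => [[]|[t]].
  rewrite inE => /asboolP[d' vA vM] /andP[/eqP vd /asboolP vi].
  move: vd; rewrite (half_degree_atom vA) => Ed; subst d'.
  case: (vA) => _ [[vS sv]|[f fN Ev]]; last first.
    by case: (pair_reducible d0 fN); rewrite -Ev.
  exists (coefT d.*2.+1 (rVpoly v)); last by rewrite polyTK ?sv // rVpolyK.
  rewrite inE polyTK ?sv //; apply/asboolP; split=> //.
  exact/(srim_norm1_root algL d0 vS sv).
rewrite inE => /asboolP[tS st tM] ->; rewrite inE tK.
have tA : atom d (polyT t) by split=> //; left.
split; first by apply/asboolP; exists d => //; apply/(srim_norm1_root algL d0 tS st).
rewrite (@half_degree_atom _ _ d) ?tK // eqxx; apply/asboolP.
by case: tS.
Qed.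

(** By unique factorization, an unordered pair of distinct reciprocal irreducibles and its product
    determine each other. *)
Lemma card_good_pairs n d M : (0 < M)%N -> (0 < d <= n)%N ->
  #|[set v in good_atoms n.*2.+1 M |
      (half_degree v == d) && ~~ `[< irreducible_poly (rVpoly v) >]]|
  = RstarM F M d.
Proof.
move=> M0 /andP[d0 dn]; have dn2 : (d.*2.+1 <= n.*2.+1)%N by rewrite ltnS leq_double.
pose T := [set t : {ffun 'I_d.+1 -> F} |
   `[< Mpower_poly M d (polyT t) /\ polyT t <> recip (polyT t) >] ].
have TN t : t \in T -> nonself d (polyT t).
  by rewrite inE => /asboolP[[]].
have RN t : t \in T -> nonself d (recip (polyT t)) by move/TN/(nonself_recip algL).
have rK t : t \in T -> recip (recip (polyT t)) = polyT t.
  by move=> /TN[tm ti tX _ _]; apply: (recip_involutive algL).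
pose h' (t : {ffun 'I_d.+1 -> F}) : 'rV[F]_(n.*2.+1) := poly_rV (polyT t * recip (polyT t)).
have h'E t : t \in T -> rVpoly (h' t) = polyT t * recip (polyT t).
  by move=> /TN tN; rewrite poly_rV_K // (pair_size iota tN).
have cT t : t \in T -> polyT (coefT d.+1 (recip (polyT t))) = recip (polyT t).
  by move=> /RN[_ _ _ sr _]; rewrite polyTK ?sr.
rewrite /RstarM -/T (@card_imset_kernel _ _ _ _ h'); last first.
  move=> t u tT uT; split=> [E|/(congr1 rVpoly)].
    have : t \in [set u; coefT d.+1 (recip (polyT u))] by rewrite -E set21.
    by rewrite !inE => /orP[/eqP-> //|/eqP->]; rewrite /h' cT // rK // mulrC.
  rewrite !h'E // => E.
  have [tm ti _ _ _] := TN _ tT; have [um ui _ _ _] := TN _ uT.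
  have [rm ri _ _ _] := RN _ uT.
  have [a ta] := ev_root_exists iota (fst ti).
  have : ev a (polyT u * recip (polyT u)) = 0 by rewrite -E; apply/ev_mul_eq0; left.
  case/ev_mul_eq0=> ua.
    have Etu := irr_monic_eq ti ui tm um ta ua.
    by rewrite (can_inj (@coefTK _ _) Etu).
  have Etu := irr_monic_eq ti ri tm rm ta ua.
  have -> : t = coefT d.+1 (recip (polyT u)) by rewrite -Etu coefTK.
  by rewrite cT // rK // coefTK setUC.
congr #|pred_of_set _|; apply/setP => v.
rewrite inE; apply/andP/imsetP => [[]|[t tT ->]].
  rewrite inE => /asboolP[d' vA vM] /andP[/eqP vd /asboolP vi].
  move: vd; rewrite (half_degree_atom vA) => Ed; subst d'.
  case: (vA) => _ [[[_ vI _] _]|[f fN Ev]]; first by case: vi.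
  have [fm fi fX sf fr] := fN.
  have fK : polyT (coefT d.+1 f) = f by rewrite polyTK ?sf.
  exists (coefT d.+1 f); last by rewrite /h' fK -Ev rVpolyK.
  rewrite inE fK; apply/asboolP; split=> //; split=> //.
  by apply/(pair_norm1_root algL fN M0); rewrite -Ev.
have tN := TN _ tT; have tA : atom d (rVpoly (h' t)).
  by rewrite h'E //; split=> //; right; exists (polyT t).
split.
  rewrite inE; apply/asboolP; exists d => //; rewrite h'E //.
  apply/(pair_norm1_root algL tN M0).
  by move: tT; rewrite inE => /asboolP[[_ _ _ _ hP] _].
rewrite (half_degree_atom tA) eqxx; apply/asboolP; rewrite h'E //.
exact: pair_reducible d0 tN.
Qed.

(** Factors are grouped by half degree, then by irreducibility of the atom; within a group all
    weights agree. *)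
Lemma prod_good_atoms n M : (0 < M)%N ->
  \prod_(v in good_atoms n.*2.+1 M)
     (1 + weight iota (rVpoly v) *: 'X^(half_degree v)) =
  \prod_(1 <= d < n.+1)
     ((1 + ((#|F|%:R ^+ d + 1)^-1) *: 'X^d) ^+ NstarM F M d
      * (1 + ((#|F|%:R ^+ d - 1)^-1) *: 'X^d) ^+ RstarM F M d) :> {poly rat}.
Proof.
move=> M0; have dP v : v \in good_atoms n.*2.+1 M -> (0 < half_degree v <= n)%N.
  rewrite inE => /asboolP[d vA _]; rewrite (half_degree_atom vA).
  have : (size (rVpoly v) <= n.*2.+1)%N by exact: size_poly.
  by rewrite (atom_size iota vA) ltnS leq_double; case: vA => ->.
pose D (v : 'rV[F]_(n.*2.+1)) : 'I_n.+1 := inord (half_degree v).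
rewrite (partition_big D (fun d => (0 < d)%N)) /=; last first.
  by move=> v /dP/andP[v0 vn]; rewrite inordK.
(* The index 0 is excluded from the grouping and contributes a factor 1, which leaves the shifted
   indices i + 1. *)
rewrite [RHS]big_add1 /= big_mkord big_mkcond big_ord_recl /= mul1r.
apply: eq_bigr => i _ /=.
set d := i.+1; have dn : (0 < d <= n)%N by rewrite /= ltn_ord.
rewrite (bigID (fun v => `[< irreducible_poly (rVpoly v) >])) /=.
have eD v : v \in good_atoms n.*2.+1 M -> (D v == lift ord0 i) = (half_degree v == d).
  by move=> /dP/andP[_ vn]; rewrite -val_eqE /= inordK.
congr (_ * _).
  rewrite -(card_good_srim M dn) -prodr_const; apply: eq_big => v.
    by rewrite !inE; case vA: `[< _ >] => //=; rewrite eD // inE vA.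
  case/andP=> /andP[vA]; rewrite eD // => /eqP vd /asboolP vi.
  move: vA vd; rewrite inE => /asboolP[d' vA _] vd.
  move: (vd); rewrite (half_degree_atom vA) => Ed; subst d'.
  case: (vA) => d0 [[vS sv]|[f fN Ev]]; first by rewrite (weight_srim iota d0 vS sv).
  by case: (pair_reducible d0 fN); rewrite -Ev.
rewrite -(card_good_pairs M0 dn) -prodr_const; apply: eq_big => v.
  by rewrite !inE; case vA: `[< _ >] => //=; rewrite eD // inE vA.
case/andP=> /andP[vA]; rewrite eD // => /eqP vd /asboolP vi.
move: vA vd; rewrite inE => /asboolP[d' vA _] vd.
move: (vd); rewrite (half_degree_atom vA) => Ed; subst d'.
case: (vA) => d0 [[[_ vI _] sv]|[f fN Ev]]; first by case: vi.
by rewrite Ev (weight_pair algL d0 fN).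
Qed.

End Counting.

Unset Implicit Arguments.

(* F = F_q (q = #|F| ranges over all prime powers). The formal power series
   identity is stated coefficientwise: for every n and every m <= n, the
   coefficient of u^m in S^M_Sp(q,u) equals the coefficient of u^m in the
   finite product over 1 <= d <= n (factors with d > m do not affect it). *)
Theorem theorem5p5 (F : finFieldType) (M : nat) :
  (2 <= M)%N -> coprime M #|F| ->
  forall n m : nat, (m <= n)%N ->
  SSp_coef F M m =
  (\prod_(1 <= d < n.+1)
     ((1 + ((#|F|%:R ^+ d + 1)^-1) *: 'X^d) ^+ NstarM F M d
      * (1 + ((#|F|%:R ^+ d - 1)^-1) *: 'X^d) ^+ RstarM F M d)
     : {poly rat})`_m.
Proof.
move=> M2 _ n m mn; have M0 := ltnW M2.
have [L [iota algL]] := countable_algebraic_closure F.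
rewrite -(prod_good_atoms algL n M0) coef_prod_good_atoms.
case: m mn => [|m] mn.
  (* A nonempty set of atoms has positive total half degree, so only the empty set contributes to
     the constant term. *)
  rewrite (big_pred1 set0) ?big_set0 // => S /=; apply/andP/eqP => [[SA /eqP S0]|->].
    apply/setP => v; rewrite inE; apply/negbTE/negP => vS.
    have := subsetP SA v vS; rewrite inE => /asboolP[d vA _].
    move/eqP: S0; rewrite (bigD1 v) //= (half_degree_atom iota vA).
    by case: vA => d0 _; rewrite addn_eq0 eqn0Ngt d0.
  by rewrite sub0set big_set0.
rewrite /SSp_coef /sSp /= (card_separable_Mth_powers algL M mn) mulfK //.
by rewrite pnatr_eq0 -lt0n Sp_card_gt0.
Qed.
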